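(* Let $\bar A=(A_0,A_1)$ be a compatible couple of (quasi-)Banach spaces with $A_0\cap A_1\neq\{0\}$. Let $0<\theta_1<1$, $0\le\theta<1$, $0<q_1,r_1,r\le\infty$, $a,a_1,b_1\in SV$, and $\left\|s^{-1/r_1}\frac{b_1(s)}{a_1(s)}\right\|_{r_1,(0,1)}<\infty$. If $\theta=0$, assume additionally that $\left\|s^{-1/r}a(s)\right\|_{r,(1,\infty)}<\infty$. Put $c_1(t)=a_1(t)\left\|s^{-1/r_1}\frac{b_1(s)}{a_1(s)}\right\|_{r_1,(0,t)}$ and $\rho(t)=t^{\theta_1}\frac{1}{c_1(t)}$ for $t>0$. Then $$\left(A_0,\bar A^{\mathcal R}_{\theta_1,r_1,b_1,q_1,a_1}\right)_{\theta,r,a}\cong\bar A_{\eta,r,a^{\#}},$$ where $\eta=\theta\theta_1$ and $a^{\#}(t)=c_1(t)^{\theta}a(\rho(t))$.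
   Context: For a compatible couple $\bar X=(X_0,X_1)$ of (quasi-)Banach spaces, $f\in X_0+X_1$ and $t>0$, $K(t,f)=K(t,f;\bar X)=\inf\{\|f_0\|_{X_0}+t\|f_1\|_{X_1}: f=f_0+f_1,\ f_i\in X_i\}$. $\|\cdot\|_{q,(c,d)}$ ($0<q\le\infty$) is the usual (quasi-)norm of the Lebesgue space $L_q$ on the interval $(c,d)$ with Lebesgue measure (variable of integration: the displayed variable; $1/\infty=0$). $SV$ is the set of positive Lebesgue measurable functions $b$ on $(0,\infty)$ that are slowly varying: for each $\varepsilon>0$, $t^{\varepsilon}b(t)$ is equivalent to an increasing function and $t^{-\varepsilon}b(t)$ is equivalent to a decreasing function, where two positive functions are equivalent if each is bounded by a constant multiple of the other. For $0\le\theta\le1$, $0<q\le\infty$, $b\in SV$, $\bar X_{\theta,q,b}=(X_0,X_1)_{\theta,q,b}$ is the space of $f\in X_0+X_1$ with $\|f\|=\left\|u^{-\theta-1/q}b(u)K(u,f)\right\|_{q,(0,\infty)}<\infty$. For $0<\sigma<1$, $0<r,q\le\infty$, $a,b\in SV$, $\bar X^{\mathcal R}_{\sigma,r,b,q,a}$ is the space of $f\in X_0+X_1$ with $\|f\|=\left\|t^{-1/r}\frac{b(t)}{a(t)}\left\|u^{-\sigma-1/q}a(u)K(u,f)\right\|_{q,(t,\infty)}\right\|_{r,(0,\infty)}<\infty$. $X\cong Y$ means that $X$ and $Y$ are continuously embedded in each other (same space, equivalent quasi-norms). *)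

(* Defs.v *)
From HB Require Import structures.
From mathcomp Require Import all_boot all_order all_algebra.
From mathcomp Require Import all_classical all_reals all_analysis.
From mathcomp Require Import measurable_realfun.
Import Order.TTheory GRing.Theory Num.Theory.
Import numFieldNormedType.Exports.

Set Implicit Arguments.
Unset Strict Implicit.
Unset Printing Implicit Defensive.

Local Open Scope classical_set_scope.
Local Open Scope ring_scope.

(* A space is a subset of an ambient vector space V together with a function
   that is meant to be its quasi-norm; the values of [qnorm] outside [carrier]
   are irrelevant.
   Scalars are real: a complex space is in particular a real one, and neither
   the K-functional nor any of the spaces below depends on the scalar field. *)
Record qspace (R : realType) (V : lmodType R) := QSpace {
  carrier : set V ;
  qnorm : V -> R }.

Record quasi_banach (R : realType) (V : lmodType R) (X : qspace V) : Prop := {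
  carrier0 : carrier X 0 ;
  carrierD : forall x y, carrier X x -> carrier X y -> carrier X (x + y) ;
  carrierZ : forall (k : R) x, carrier X x -> carrier X (k *: x) ;
  qnorm_ge0 : forall x, carrier X x -> 0 <= qnorm X x ;
  qnorm_eq0 : forall x, carrier X x -> qnorm X x = 0 -> x = 0 ;
  qnormZ : forall (k : R) x, carrier X x -> qnorm X (k *: x) = `|k| * qnorm X x ;
  qnormD : exists C : R, forall x y, carrier X x -> carrier X y ->
    qnorm X (x + y) <= C * (qnorm X x + qnorm X y) ;
  qnorm_complete : forall u : nat -> V, (forall n, carrier X (u n)) ->
    (forall e, 0 < e -> exists N : nat, forall m n : nat,
       (N <= m)%N -> (N <= n)%N -> qnorm X (u m - u n) < e) ->
    exists2 x, carrier X x & qnorm X (u n - x) @[n --> \oo] --> (0 : R) }.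

(* By linearity, continuity of the inclusion of X into V amounts to continuity
   at the origin. *)
Definition embedded_in_tvs (R : realType) (V : topologicalLmodType R)
    (X : qspace V) : Prop :=
  forall U : set V, nbhs 0 U ->
    exists2 e : R, 0 < e & forall x, carrier X x -> qnorm X x < e -> U x.

Record compatible_couple (R : realType) (V : topologicalLmodType R)
    (X0 X1 : qspace V) : Prop := {
  ambient_hausdorff : hausdorff_space V ;
  quasi_banach_fst : quasi_banach X0 ;
  quasi_banach_snd : quasi_banach X1 ;
  embedded_fst : embedded_in_tvs X0 ;
  embedded_snd : embedded_in_tvs X1 }.

Definition cont_embedded (R : realType) (V : lmodType R) (X Y : qspace V) : Prop :=
  carrier X `<=` carrier Y /\
  exists C : R, forall x, carrier X x -> qnorm Y x <= C * qnorm X x.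

Definition qspace_equiv (R : realType) (V : lmodType R) (X Y : qspace V) : Prop :=
  cont_embedded X Y /\ cont_embedded Y X.

Notation "X ~=~ Y" := (qspace_equiv X Y) (at level 70).

Definition sum_set (R : realType) (V : lmodType R) (X0 X1 : qspace V) : set V :=
  [set f0 + f1 | f0 in carrier X0 & f1 in carrier X1].

(* For f outside X0 + X1 the infimum is over the empty set, hence +oo. *)
Definition Kfun (R : realType) (V : lmodType R) (X0 X1 : qspace V)
    (t : R) (f : V) : \bar R :=
  ereal_inf [set (qnorm X0 p.1 + t * qnorm X1 p.2)%:E | p in
    [set p : V * V | [/\ carrier X0 p.1, carrier X1 p.2 & f = p.1 + p.2]]].

(* The integral in [Lnorm] of a nonnegative function is a supremum over Borel
   simple functions below it, and [Lnorm] at +oo only depends on null sets; so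
   for nonnegative Lebesgue measurable f, Borel or not, this is the usual
   quasi-norm. As 0 < q, extending f by 0 outside D does not affect it. *)
Definition Lqnorm (R : realType) (q : \bar R) (D : set R) (f : R -> \bar R) :
  \bar R := Lnorm (@lebesgue_measure R) q (f \_ D).

(* 1/q, with 1/oo = 0 *)
Definition recip (R : realType) (q : \bar R) : R :=
  if q is q'%:E then q'^-1 else 0.

Definition positive_on_half_line (R : realType) (f : R -> R) : Prop :=
  forall t, 0 < t -> 0 < f t.

Definition bounded_by_multiple (R : realType) (f g : R -> R) : Prop :=
  exists C : R, forall t, 0 < t -> f t <= C * g t.

Definition equivalent (R : realType) (f g : R -> R) : Prop :=
  bounded_by_multiple f g /\ bounded_by_multiple g f.

Definition lebesgue_type (R : realType) :=
  g_sigma_algebraType (completed_algebra_gen (@lebesgue_measure R)).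

(* "Increasing" and "decreasing" are in the wide sense; since eps is arbitrary,
   the strict versions define the same class. *)
Record SV (R : realType) (b : R -> R) : Prop := {
  SV_pos : positive_on_half_line b ;
  SV_measurable :
    measurable_fun (`]0, +oo[ : set (lebesgue_type R)) (b : lebesgue_type R -> R) ;
  SV_incr : forall eps, 0 < eps -> exists g : R -> R,
    [/\ positive_on_half_line g,
        equivalent (fun t => t `^ eps * b t) g &
        forall s t, 0 < s -> s <= t -> g s <= g t] ;
  SV_decr : forall eps, 0 < eps -> exists g : R -> R,
    [/\ positive_on_half_line g,
        equivalent (fun t => t `^ (- eps) * b t) g &
        forall s t, 0 < s -> s <= t -> g t <= g s] }.

Definition Kspace (R : realType) (V : lmodType R) (X0 X1 : qspace V)
    (theta : R) (q : \bar R) (b : R -> R) : qspace V :=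
  let N f := Lqnorm q `]0, +oo[
    (fun u => (u `^ (- theta - recip q) * b u)%:E * Kfun X0 X1 u f)%E in
  QSpace [set f | sum_set X0 X1 f /\ (N f < +oo)%E] (fun f => fine (N f)).

Definition Rspace (R : realType) (V : lmodType R) (X0 X1 : qspace V)
    (sigma : R) (r : \bar R) (b : R -> R) (q : \bar R) (a : R -> R) : qspace V :=
  let N f := Lqnorm r `]0, +oo[
    (fun t => (t `^ (- recip r) * (b t / a t))%:E *
       Lqnorm q `]t, +oo[
         (fun u => (u `^ (- sigma - recip q) * a u)%:E * Kfun X0 X1 u f))%E in
  QSpace [set f | sum_set X0 X1 f /\ (N f < +oo)%E] (fun f => fine (N f)).

(* Main.v *)
Require Import Defs.
From HB Require Import structures.
From mathcomp Require Import all_boot all_order all_algebra.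
From mathcomp Require Import all_classical all_reals all_analysis.
From mathcomp Require Import measurable_realfun ess_sup_inf zify ring lra.
Import Order.TTheory GRing.Theory Num.Theory.
Import numFieldNormedType.Exports.

(** Write [X] for the space [Rspace A0 A1 theta1 r1 b1 q1 a1] and [L t] for the
    norm of [s^(-1/r1) b1(s)/a1(s)] on [(0, t)], so that
    [rho(t) = t^theta1 / (a1(t) L(t))].  For small [eps > 0],
[[
    K(t, f; A0, A1) <~ K(rho(t), f; A0, X)
                    <~ rho(t) sup_(u >= t) (u/t)^eps K(u, f; A0, A1) / rho(u).
]]
    The first estimate is [K(t, g; A0, A1) <~ rho(t) ||g||_X], obtained by
    keeping only [s < t < u < e t] in the norm of [X].  For the second, take a
    nearly optimal decomposition [f = f0 + f1] at [t]: the bounds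
    [K(u, f1) <= u ||f1||_A1] for [u <= t] and
    [K(u, f1) <~ K(u, f) + ||f0||_A0] for [u >= t] control [||f1||_X].
    Sampling at [u = e^k], both inclusions become Schur tests on sequences with
    kernel [exp(-del |j - ln rho(e^k)|)], whose sums are bounded because
    [rho(e^k)] grows geometrically; estimating by suprema instead of by sums
    makes the argument the same for all exponents in [(0, +oo]].

    The functions under the norms are not Borel, so integrals are only used
    through monotonicity, homogeneity and subadditivity over domains. *)

Local Open Scope classical_set_scope.
Local Open Scope ring_scope.

Set Implicit Arguments.
Unset Strict Implicit.

(** * Integrals of nonnegative functions without measurability *)

Section nonmeasurable_integral.
Context d (T : measurableType d) (R : realType).
Variable mu : {measure set T -> \bar R}.
Local Open Scope ereal_scope.
Implicit Types f g : T -> \bar R.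
Import HBNNSimple.

(** The integral of a nonnegative function is by definition the supremum of the integrals of the
    simple functions below it, measurable or not. Each inequality of this section is checked on
    those simple functions, for which the measurable theory applies. *)
Lemma nonneg_integral_le_sup f (M : \bar R) : (forall x, 0 <= f x) ->
  (forall h : {nnsfun T >-> R}, (forall x, (h x)%:E <= f x) ->
    \int[mu]_x (h x)%:E <= M) ->
  \int[mu]_x f x <= M.
Proof.
move=> f0 hM; rewrite ge0_integralTE//; apply: ge_ereal_sup => _ [h /= hf <-].
by rewrite -integralT_nnsfun; exact: hM.
Qed.

Lemma nonneg_le_integral f g : (forall x, 0 <= f x) -> (forall x, f x <= g x) ->
  \int[mu]_x f x <= \int[mu]_x g x.
Proof.
move=> f0 fg; apply: nonneg_integral_le_sup => // h hf.
have g0 x : 0 <= g x by rewrite (le_trans (f0 x)).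
rewrite integralT_nnsfun ge0_integralTE//.
by apply: ereal_sup_ubound; exists h => //= x; rewrite (le_trans (hf x)).
Qed.

Lemma nonneg_integralZl_le f (c : R) : (0 <= c)%R -> (forall x, 0 <= f x) ->
  c%:E * \int[mu]_x f x <= \int[mu]_x (c%:E * f x).
Proof.
move=> c0 f0; have cf0 x : 0 <= c%:E * f x by rewrite mule_ge0// lee_fin.
move: c0; rewrite le_eqVlt => /predU1P[c0|c0].
  by rewrite -c0 mul0e integral_ge0// => x _; rewrite c0.
rewrite -lee_pdivlMl//; apply: nonneg_integral_le_sup => // h hf.
rewrite lee_pdivlMl// -ge0_integralZl//; last 3 first.
- exact: measurableT_comp.
- by move=> x _; rewrite lee_fin.
- exact: ltW.
apply: nonneg_le_integral => x; first by rewrite mule_ge0// lee_fin// ltW.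
by rewrite lee_pmul2l.
Qed.

Lemma nonneg_integralZl f (c : R) : (0 < c)%R -> (forall x, 0 <= f x) ->
  \int[mu]_x (c%:E * f x) = c%:E * \int[mu]_x f x.
Proof.
move=> c0 f0; apply/eqP; rewrite eq_le; apply/andP; split; last first.
  by apply: nonneg_integralZl_le => //; exact: ltW.
rewrite -lee_pdivrMl//.
(* The reverse inequality is the previous one for the function [c * f] and the factor [c^-1]. *)
have := @nonneg_integralZl_le (fun x => c%:E * f x) c^-1.
rewrite invr_ge0 => /(_ (ltW c0)) H; apply: le_trans (H _) _ => [x|].
  by rewrite mule_ge0// lee_fin ltW.
by under eq_integral do rewrite muleA -EFinM mulVf ?gt_eqF// mul1e.
Qed.

(** A simple function below [f] on the union is cut along [A], which is where measurability of [A]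
    enters. Outside [A] it lies below the restriction of [f] to [B]. *)
Lemma nonneg_integralU_le f (A B : set T) : measurable A ->
  (forall x, 0 <= f x) ->
  \int[mu]_x (f \_ (A `|` B)) x <= \int[mu]_x (f \_ A) x + \int[mu]_x (f \_ B) x.
Proof.
move=> mA f0; have fp D x : 0 <= (f \_ D) x by exact: erestrict_ge0.
apply: nonneg_integral_le_sup => // h hf.
have -> : \int[mu]_x (h x)%:E =
    \int[mu]_(x in A) (h x)%:E + \int[mu]_(x in ~` A) (h x)%:E.
  rewrite -ge0_integral_setU ?setUv//; first exact: measurableC.
  - exact: measurableT_comp.
  - by move=> x _; rewrite lee_fin.
  - by rewrite disj_set2E setICr.
have h0 D x : 0 <= ((EFin \o h) \_ D) x.
  by apply: erestrict_ge0 => y _; rewrite lee_fin.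
rewrite !(integral_mkcond _ (fun x => (h x)%:E)).
apply: leeD; apply: nonneg_le_integral => x; first exact: h0.
- rewrite /patch; case: ifPn => // xA; apply: le_trans (hf x) _.
  by rewrite /patch classical_sets.in_setU xA.
- exact: h0.
- have := hf x; rewrite /patch classical_sets.in_setU classical_sets.in_setC.
  by case: (x \in A); case: (x \in B).
Qed.

End nonmeasurable_integral.

(** * The functional Lqnorm *)

Section Lqnorm.
Context (R : realType).
Local Open Scope ereal_scope.
Implicit Types (f g : R -> \bar R) (q : \bar R) (A B D E : set R).
Local Notation mu := (@lebesgue_measure R).

Lemma ge0_poweRV_le (r : R) (x y : \bar R) : (0 < r)%R -> 0 <= x -> 0 <= y ->
  (x `^ r^-1 <= y) = (x <= y `^ r).
Proof.
move=> r0 x0 y0; have rV0 : (0 <= r^-1)%R by rewrite invr_ge0 ltW.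
have r00 := ltW r0; have rn0 : r != 0%R by rewrite gt_eqF.
apply/idP/idP => xy.
  rewrite -(@poweRe1 _ x)// -(mulVf rn0) poweRrM.
  by apply: gt0_ler_poweR; rewrite ?in_itv /= ?leey ?poweR_ge0 ?y0.
rewrite -(@poweRe1 _ y)// -(mulfV rn0) poweRrM.
by apply: gt0_ler_poweR; rewrite ?in_itv /= ?leey ?poweR_ge0 ?x0.
Qed.

Lemma recip_EFin (r : R) : recip r%:E = (r^-1)%R. Proof. by []. Qed.

Lemma patch_absE (r : R) f D : r != 0%R ->
  (fun x => `|(f \_ D) x| `^ r) = (fun x => `|f x| `^ r) \_ D.
Proof.
move=> r0; apply/funext => x; rewrite /patch; case: ifPn => // _.
by rewrite abse0 poweR0r.
Qed.

Lemma Lqnorm_finE (r : R) D f : (0 < r)%R ->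
  Lqnorm r%:E D f = (\int[mu]_x ((fun x => `|f x| `^ r) \_ D) x) `^ r^-1.
Proof. by move=> r0; rewrite /Lqnorm unlock -patch_absE// gt_eqF. Qed.

Lemma LqnormyE D f : Lqnorm +oo D f = ess_sup mu (abse \o (f \_ D)).
Proof.
have muT : 0 < mu [set: R] by rewrite -set_itvNyy lebesgue_measure_itv/= ltry.
by rewrite /Lqnorm unlock muT.
Qed.

Lemma Lqnorm_ge0 q D f : 0 <= Lqnorm q D f.
Proof. exact: Lnorm_ge0. Qed.

Lemma le_Lqnorm q D E f g : 0 < q -> D `<=` E ->
  (forall x, D x -> 0 <= f x) -> (forall x, D x -> f x <= g x) ->
  Lqnorm q D f <= Lqnorm q E g.
Proof.
move=> q0 DE f0 fg.
have fgab x : `|(f \_ D) x| <= `|(g \_ E) x|.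
  rewrite /patch; case: ifPn => [|_]; last by rewrite abse0 abse_ge0.
  rewrite inE => Dx; rewrite ifT; last by rewrite inE; exact: DE.
  have [fx0 fgx] := (f0 x Dx, fg x Dx).
  by rewrite !gee0_abs//; exact: le_trans fgx.
case: q q0 => [r| |]//; last by rewrite !LqnormyE => _; exact/le_ess_sup/aeW.
rewrite lte_fin => r0; have r00 := ltW r0.
rewrite /Lqnorm unlock; apply: gt0_ler_poweR.
- by rewrite invr_ge0.
- by rewrite in_itv /= leey andbT integral_ge0// => x _; exact: poweR_ge0.
- by rewrite in_itv /= leey andbT integral_ge0// => x _; exact: poweR_ge0.
apply: nonneg_le_integral => x; first exact: poweR_ge0.
by apply: gt0_ler_poweR; rewrite ?in_itv /= ?leey ?abse_ge0.
Qed.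

Lemma LqnormZ q D f (c : R) : 0 < q -> (0 < c)%R ->
  Lqnorm q D (fun x => c%:E * f x) = c%:E * Lqnorm q D f.
Proof.
move=> q0 c0.
have cf x : `|((fun x => c%:E * f x) \_ D) x| = c%:E * `|(f \_ D) x|.
  rewrite /patch; case: ifPn => _; last by rewrite abse0 mule0.
  by rewrite abseM gee0_abs// lee_fin ltW.
case: q q0 => [r| |]//.
  rewrite lte_fin => r0; rewrite /Lqnorm unlock.
  under eq_integral do rewrite cf poweRM ?abse_ge0 ?lee_fin ?(ltW c0)// poweR_EFin.
  rewrite nonneg_integralZl ?powR_gt0//; last by move=> x; exact: poweR_ge0.
  rewrite poweRM ?lee_fin ?powR_ge0//; last first.
    by apply: integral_ge0 => x _; exact: poweR_ge0.
  by rewrite poweR_EFin -powRrM mulfV ?gt_eqF// powRr1// ltW.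
by move=> _; rewrite !LqnormyE -ess_sup_pZl//; congr ess_sup; exact/funext.
Qed.

(** With one bound [M] for both pieces, the q-th powers add up to at most twice the q-th power of
    [M]. This gives the factor 2^(1/q), equal to 1 at [+oo]. *)
Lemma LqnormU_le q A B f (M : R) : 0 < q -> measurable A -> (0 <= M)%R ->
  Lqnorm q A f <= M%:E -> Lqnorm q B f <= M%:E ->
  Lqnorm q (A `|` B) f <= (2 `^ (recip q) * M)%:E.
Proof.
move=> q0 mA M0; case: q q0 => [r| |]//.
  rewrite lte_fin => r0; rewrite !Lqnorm_finE//.
  have i0 D : 0 <= \int[mu]_x (((fun x => `|f x| `^ r) \_ D) x).
    by apply: integral_ge0 => x _; apply: erestrict_ge0 => *; exact: poweR_ge0.
  rewrite !ge0_poweRV_le ?lee_fin ?mulr_ge0 ?powR_ge0// !poweR_EFin => hA hB.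
  have H := @nonneg_integralU_le _ _ _ mu (fun x => `|f x| `^ r) A B mA.
  apply: (le_trans (H _)).
    by move=> x; exact: poweR_ge0.
  apply: le_trans (leeD hA hB) _.
  rewrite powRM ?powR_ge0// recip_EFin -powRrM mulVf ?gt_eqF// powRr1//.
  by rewrite mulrDl mul1r EFinD.
move=> _; rewrite !LqnormyE /= powRr0 mul1r => /ess_supP hA /ess_supP hB.
apply/ess_supP; move: hA hB; apply: filterS2 => x /=.
rewrite /patch classical_sets.in_setU.
by case: (x \in A); case: (x \in B).
Qed.

End Lqnorm.

(** * Step functions on the intervals [e^k, e^(k+1)) *)

Section discretization.
Context (R : realType).
Implicit Types (f g : R -> \bar R) (q : \bar R) (A B D E : set R).
Local Notation mu := (@lebesgue_measure R).

Lemma expR1_ge2 : 2 <= expR 1 :> R.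
Proof. by have := expR_ge1Dx (1 : R); lra. Qed.

Lemma recip_ge0 q : (0 < q)%E -> 0 <= recip q.
Proof. by case: q => [r| |]//=; rewrite lte_fin invr_ge0 => /ltW. Qed.

Lemma Lqnorm_cst q (s t v : R) : (0 < q)%E -> s < t -> 0 <= v ->
  Lqnorm q `]s, t[ (cst v%:E) = (v * (t - s) `^ recip q)%:E.
Proof.
move=> q0 st v0; have ts : 0 <= t - s by rewrite subr_ge0 ltW.
have mst : mu `]s, t[%classic = (t - s)%:E.
  by rewrite lebesgue_measure_itv/= lte_fin st EFinB.
case: q q0 => [r| |]//.
  rewrite lte_fin => r0; rewrite Lqnorm_finE// -integral_mkcond /=.
  rewrite ger0_norm// integral_cst//= mst -EFinM poweR_EFin.
  by rewrite powRM ?powR_ge0// -powRrM mulfV ?gt_eqF// powRr1.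
move=> _; rewrite LqnormyE /= powRr0 mulr1; apply/eqP; rewrite eq_le; apply/andP; split.
  apply/ess_supP/aeW => x /=; rewrite /patch; case: ifP => _ /=.
    by rewrite ger0_norm.
  by rewrite normr0 lee_fin.
(* If the essential supremum were below [v], the whole interval would lie in a null set. *)
rewrite leNgt; apply/negP => lt_v.
have : {ae mu, forall x, ~ `]s, t[%classic x}.
  have := ess_sup_ge mu (abse \o (cst v%:E \_ `]s, t[)).
  apply: filterS => x /= + xst; rewrite /patch ifT ?inE//= ger0_norm// => /le_lt_trans.
  by move=> /(_ _ lt_v); rewrite ltxx.
move=> [N [mN N0 sN]].
have : (mu `]s, t[%classic <= mu N)%E.
  by apply: le_measure; rewrite ?inE// => x xst; apply: sN; exact.
by rewrite N0 mst lee_fin subr_le0 leNgt st.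
Qed.

(** On the interval from s to e s, u^(-1/q) is at least (e s)^(-1/q), and the length (e - 1) s is at
    least half of e s. The dependence on [s] cancels, leaving 2^(-1/q). *)
Lemma Lqnorm_ge q D f (s m : R) : (0 < q)%E -> 0 < s -> 0 <= m ->
  `]s, expR 1 * s[ `<=` D ->
  (forall u, s < u < expR 1 * s -> ((m * u `^ (- recip q))%:E <= f u)%E) ->
  ((2 `^ (- recip q) * m)%:E <= Lqnorm q D f)%E.
Proof.
move=> q0 s0 m0 sD fm; have e2 := expR1_ge2; have rq := recip_ge0 q0.
have ses : s < expR 1 * s by nra.
have es0 : 0 < expR 1 * s by nra.
pose v := m * (expR 1 * s) `^ (- recip q).
have v0 : 0 <= v by rewrite mulr_ge0 ?powR_ge0.
apply: (@le_trans _ _ (Lqnorm q `]s, expR 1 * s[ (cst v%:E))); last first.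
  apply: le_Lqnorm => // u /=; rewrite ?lee_fin// in_itv /= => /andP[su us].
  apply: le_trans (fm u _); last by rewrite su us.
  have u0 : 0 < u by exact: lt_trans su.
  rewrite lee_fin ler_wpM2l// !powRN lef_pV2 ?posrE ?powR_gt0//.
  by apply: ge0_ler_powR => //; rewrite ?nnegrE ltW.
rewrite Lqnorm_cst// lee_fin /v mulrC -mulrA ler_wpM2l//.
rewrite !powRN ler_pdivlMl ?powR_gt0// mulrC ler_pdivrMl ?powR_gt0//.
rewrite -powRM ?subr_ge0 ?(ltW ses)//.
by apply: ge0_ler_powR => //; rewrite ?nnegrE; nra.
Qed.

(** The enumeration 0, -1, 1, -2, 2, ... of the integers, through which unions and series indexed by
    [nat] become unions and sums over [int]. *)
Definition zenum (n : nat) : int := if odd n then Negz n./2 else Posz n./2.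

Lemma zenum_bij : set_bij [set: nat] [set: int] zenum.
Proof.
split => // [m n _ _|[n|n] _].
  rewrite /zenum; case: ifP => om; case: ifP => on // -[mn].
    by rewrite -(odd_double_half m) -(odd_double_half n) om on mn.
  by rewrite -(odd_double_half m) -(odd_double_half n) om on mn.
- by exists n.*2 => //; rewrite /zenum odd_double doubleK.
- by exists n.*2.+1 => //; rewrite /zenum /= odd_double /= uphalf_double.
Qed.

Definition eitv (k : int) : set R := `[expR k%:~R, expR (k + 1)%:~R[.

Lemma eitvP (u : R) k : 0 < u -> eitv k u <-> Num.floor (ln u) = k.
Proof.
move=> u0; rewrite /eitv /= in_itv /=.
have -> : (expR k%:~R <= u) = (k%:~R <= ln u) by rewrite -[in LHS](lnK u0) ler_expR.
have -> : (u < expR (k + 1)%:~R) = (ln u < (k + 1)%:~R) by rewrite -[in LHS](lnK u0) ltr_expR.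
split=> [|<-]; first exact: floor_def.
by rewrite real_floor_itv ?num_real.
Qed.

Lemma eitv_gt0 (u : R) k : eitv k u -> 0 < u.
Proof. by rewrite /eitv /= in_itv /= => /andP[+ _]; apply/lt_le_trans/expR_gt0. Qed.

Lemma mu_eitv k : mu (eitv k) = (expR k%:~R * (expR 1 - 1))%:E.
Proof.
rewrite /eitv lebesgue_measure_itv /= lte_fin ltr_expR ltr_int ltrDl ltr01.
by rewrite -EFinB intrD expRD mulrBr mulr1.
Qed.

(** A function of the integer part of [ln u] is Borel, so countable additivity is available for it.
    General integrands will only be compared with such step functions. *)
Lemma integral_step (v : int -> R) : (forall k, 0 <= v k) ->
  (\int[mu]_(u in `]0%R, +oo[) (v (Num.floor (ln u)))%:E =
   \esum_(k in [set: int]) (v k * (expR k%:~R * (expR 1 - 1)))%:E)%E.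
Proof.
move=> v0.
have DE : `]0%R, +oo[%classic = \bigcup_n eitv (zenum n) :> set R.
  apply/seteqP; split => u /=; rewrite in_itv /= andbT; last first.
    by move=> [n _] /eitv_gt0.
  move=> u0; have [_ _ /(_ (Num.floor (ln u)) I)[n _ nE]] := zenum_bij.
  by exists n => //; apply/eitvP.
have cstE k u : eitv k u -> (v (Num.floor (ln u)))%:E = (v k)%:E.
  by move=> uk; move: (uk) => /(eitvP _ (eitv_gt0 uk)) ->.
have [_ inj _] := zenum_bij.
rewrite DE ge0_integral_bigcup//=; first last.
- apply/trivIsetP => m n _ _ mn; rewrite -subset0 => u [um un].
  have u0 := eitv_gt0 um.
  move: um un => /(eitvP _ u0) um /(eitvP _ u0); rewrite um => /inj.
  by rewrite !inE => /(_ I I) nm; rewrite nm eqxx in mn.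
- by move=> u _; rewrite lee_fin.
- apply/measurable_fun_bigcup => [n|n]; first exact: measurable_itv.
  apply: (eq_measurable_fun (cst (v (zenum n))%:E)) => // u; rewrite inE.
  by move=> /cstE.
- by move=> n; exact: measurable_itv.
rewrite (reindex_esum setT _ zenum) -?nneseries_esumT//; last exact: zenum_bij.
  apply: eq_eseriesr => n _.
  under eq_integral => u do [rewrite inE => /cstE ->].
  rewrite integral_cst /=; last exact: measurable_itv.
  by rewrite [X in (_ * X)%E]mu_eitv EFinM.
by move=> n; rewrite lee_fin !mulr_ge0 ?expR_ge0// subr_ge0 (le_trans _ expR1_ge2)// ler1n.
Qed.

End discretization.

(** * Sequence norms and the Schur test *)

Section sequence_norm.
Context (R : realType).
Implicit Types (f g : R -> \bar R) (q : \bar R) (x y : int -> R) (D : set R).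

(** The quasi-norm of l_q over the integers, without absolute values because it is applied to
    nonnegative sequences. The last branch is meant for [q = +oo]. *)
Definition lq q x : \bar R :=
  if q is r%:E then ((\esum_(k in [set: int]) (x k `^ r)%:E) `^ r^-1)%E
  else ereal_sup [set (x k)%:E | k in [set: int]].

Lemma powRE (u p : R) : 0 < u -> u `^ p = expR (p * ln u).
Proof. by move=> u0; rewrite /powR gt_eqF. Qed.

Lemma ln_floor (u : R) :
  (Num.floor (ln u))%:~R <= ln u < (Num.floor (ln u))%:~R + 1.
Proof. by have := @real_floor_itv R (ln u) (num_real _); rewrite intrD. Qed.

Lemma esumZ_le (T : choiceType) (I : set T) (a : T -> \bar R) (c : R) :
  0 <= c -> (forall i, 0 <= a i)%E ->
  (\esum_(i in I) (c%:E * a i) <= c%:E * \esum_(i in I) a i)%E.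
Proof.
move=> c0 a0; apply: ge_ereal_sup => _ [A [finA AI] <-].
rewrite -ge0_mule_fsumr//.
apply: lee_wpmul2l; first by rewrite lee_fin.
by apply: ereal_sup_ubound; exists A.
Qed.

Lemma esum_swap (a : int -> int -> \bar R) : (forall i j, 0 <= a i j)%E ->
  \esum_(i in [set: int]) \esum_(j in [set: int]) a i j =
  \esum_(j in [set: int]) \esum_(i in [set: int]) a i j.
Proof.
move=> a0; rewrite !esum_esum//.
rewrite (reindex_esum ([set: int] `*` [set: int]) _ (fun x : int * int => (x.2, x.1)))//=.
split=> //= [[i j] [i' j'] _ _ /= [-> ->]//|[i j] _].
by exists (j, i).
Qed.

Lemma Lqnorm_step (r : R) (v : int -> R) : 0 < r -> (forall k, 0 <= v k) ->
  Lqnorm r%:E `]0, +oo[ (fun u => (v (Num.floor (ln u)))%:E) =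
  ((\esum_(k in [set: int]) (v k `^ r * (expR k%:~R * (expR 1 - 1)))%:E)
     `^ r^-1)%E.
Proof.
move=> r0 v0; rewrite Lqnorm_finE// -integral_mkcond; congr (_ `^ _)%E.
rewrite -integral_step => [|k]; last exact: powR_ge0.
by apply: eq_integral => u _; rewrite /= ger0_norm.
Qed.

Lemma Lqnorm_le_lq q D f x : (0 < q)%E -> D `<=` `]0, +oo[ ->
  (forall u, D u -> (0 <= f u)%E) -> (forall k, 0 <= x k) ->
  (forall u, D u -> (f u <= (u `^ (- recip q) * x (Num.floor (ln u)))%:E)%E) ->
  (Lqnorm q D f <= (expR (recip q))%:E * lq q x)%E.
Proof.
move=> q0 D0 f0 x0 fx; case: q q0 fx => [r| |]//=; last first.
  move=> _ fx; rewrite LqnormyE expR0 mul1e; apply/ess_supP/aeW => u /=.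
  rewrite /patch; case: ifPn => [|_]; last first.
    rewrite abse0; apply: le_trans (ereal_sup_ubound _); last by exists 0.
    by rewrite lee_fin.
  rewrite inE => Du; rewrite gee0_abs ?f0//.
  apply: le_trans (fx u Du) _; rewrite oppr0 powRr0 mul1r.
  by apply: ereal_sup_ubound; exists (Num.floor (ln u)).
rewrite lte_fin => r0 fx; have rV0 : 0 <= r^-1 by rewrite invr_ge0 ltW.
(* The factor e^(-k/r) is the largest value of u^(-1/r) on [eitv k]. Its r-th power cancels the
   length of that interval up to e - 1, which is at most e. *)
pose v k := expR (- r^-1 * k%:~R) * x k.
have v0 k : 0 <= v k by rewrite mulr_ge0 ?expR_ge0.
apply: (@le_trans _ _ (Lqnorm r%:E `]0, +oo[ (fun u => (v (Num.floor (ln u)))%:E))).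
  apply: le_Lqnorm => // u Du; apply: le_trans (fx u Du) _.
  have := D0 u Du; rewrite /= in_itv /= andbT => u0.
  rewrite lee_fin ler_wpM2r// powRE// ler_expR !mulNr lerN2 ler_wpM2l//.
  by have /andP[] := ln_floor u.
rewrite Lqnorm_step// ge0_poweRV_le//; last 2 first.
- apply: esum_ge0 => k _; have := expR1_ge2 R.
  by rewrite lee_fin mulr_ge0 ?powR_ge0 ?mulr_ge0 ?expR_ge0//; lra.
- by rewrite mule_ge0 ?lee_fin ?expR_ge0// poweR_ge0.
rewrite poweRM ?lee_fin ?expR_ge0 ?poweR_ge0// -poweRrM mulVf ?gt_eqF//.
rewrite poweRe1; last by apply: esum_ge0 => k _; rewrite lee_fin powR_ge0.
rewrite poweR_EFin powRE ?expR_gt0// expRK mulfV ?gt_eqF//.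
have e2 := expR1_ge2 R.
apply: (@le_trans _ _ ((expR 1 - 1)%:E * \esum_(k in [set: int]) (x k `^ r)%:E)%E).
  apply: le_trans (esumZ_le _ _ _); last 2 first.
  - by lra.
  - by move=> k; rewrite lee_fin powR_ge0.
  apply: le_esum => k _; rewrite -EFinM lee_fin /v powRM ?expR_ge0//.
  rewrite [X in X * _ * _](_ : _ = (expR k%:~R)^-1).
    rewrite [leLHS](_ : _ = (expR 1 - 1) * x k `^ r)//.
    by field; rewrite gt_eqF ?expR_gt0.
  by rewrite powRE ?expR_gt0// expRK -expRN; congr expR; field; rewrite gt_eqF.
apply: lee_wpmul2r; last by rewrite lee_fin; lra.
by apply: esum_ge0 => k _; rewrite lee_fin powR_ge0.
Qed.

Lemma lq_le_Lqnorm q f x : (0 < q)%E -> (forall k, 0 <= x k) ->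
  (forall u, 0 < u ->
     ((u `^ (- recip q) * x (Num.floor (ln u)))%:E <= f u)%E) ->
  (lq q x <= (expR (recip q))%:E * Lqnorm q `]0%R, +oo[ f)%E.
Proof.
move=> q0 x0 fx; case: q q0 fx => [r| |]//=; last first.
  move=> _ fx; rewrite expR0 mul1e; apply: ge_ereal_sup => _ [k _ <-].
  have := @Lqnorm_ge R +oo%E `]0, +oo[ f (expR k%:~R) (x k).
  rewrite /= oppr0 powRr0 mul1r; apply => //.
    move=> u /=; rewrite !in_itv /= andbT => /andP[+ _].
    by apply: lt_trans; exact: expR_gt0.
  move=> u /andP[ku uk].
  have u0 : 0 < u by apply: lt_trans ku; exact: expR_gt0.
  apply: le_trans (fx u u0); rewrite oppr0 !powRr0 mulr1 mul1r.
  suff /(eitvP _ u0) -> : eitv k u by [].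
  by rewrite /eitv /= in_itv /= ltW//= intrD addrC expRD.
rewrite lte_fin => r0 fx; have rV0 : 0 <= r^-1 by rewrite invr_ge0 ltW.
(* Now the infimum of u^(-1/r) on [eitv k] is taken. Against the length of the interval it leaves 1
   - 1/e, which is at least 1/e. *)
pose v k := expR (- r^-1 * (k%:~R + 1)) * x k.
have v0 k : 0 <= v k by rewrite mulr_ge0 ?expR_ge0.
apply: (@le_trans _ _ ((expR r^-1)%:E *
    Lqnorm r%:E `]0%R, +oo[ (fun u => (v (Num.floor (ln u)))%:E))%E); last first.
  apply: lee_wpmul2l; first by rewrite lee_fin expR_ge0.
  apply: le_Lqnorm => // u /=.
    by rewrite lee_fin.
  rewrite in_itv /= andbT => u0; apply: le_trans (fx u u0).
  rewrite lee_fin ler_wpM2r// powRE// ler_expR !mulNr lerN2 ler_wpM2l//.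
  by have /andP[_ /ltW] := ln_floor u.
have X0 : (0 <= \esum_(k in [set: int]) (x k `^ r)%:E)%E.
  by apply: esum_ge0 => k _; rewrite lee_fin powR_ge0.
have V0 : (0 <= \esum_(k in [set: int]) (v k `^ r * (expR k%:~R * (expR 1 - 1)))%:E)%E.
  apply: esum_ge0 => k _; have := expR1_ge2 R.
  by rewrite lee_fin mulr_ge0 ?powR_ge0 ?mulr_ge0 ?expR_ge0//; lra.
rewrite Lqnorm_step// ge0_poweRV_le//; last first.
  by rewrite mule_ge0 ?lee_fin ?expR_ge0// poweR_ge0.
rewrite poweRM ?lee_fin ?expR_ge0 ?poweR_ge0// -poweRrM mulVf ?gt_eqF//.
rewrite poweRe1// poweR_EFin powRE ?expR_gt0// expRK mulfV ?gt_eqF//.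
rewrite -lee_pdivrMl ?expR_gt0//.
apply: le_trans (_ : _ <= \esum_(k in [set: int]) (expR 1)^-1%:E * (x k `^ r)%:E)%E _.
  rewrite lee_pdivrMl ?expR_gt0//.
  apply: le_trans (esumZ_le _ _ _); last 2 first.
  - exact: expR_ge0.
  - by move=> k; rewrite -EFinM lee_fin mulr_ge0 ?invr_ge0 ?expR_ge0 ?powR_ge0.
  by apply: le_esum => k _; rewrite -!EFinM mulrA mulfV ?gt_eqF ?expR_gt0// mul1r.
have e2 := expR1_ge2 R.
apply: le_esum => k _; rewrite -EFinM lee_fin /v powRM ?expR_ge0//.
rewrite [X in _ <= X * _ * _](_ : _ = expR (- k%:~R - 1)).
  rewrite mulrAC -expRN ler_wpM2r ?powR_ge0// mulrA -expRD.
  rewrite (_ : _ + _ = - 1); last by ring.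
  by rewrite ler_peMr ?expR_ge0//; lra.
by rewrite powRE ?expR_gt0// expRK; congr expR; field; rewrite gt_eqF.
Qed.

(* The hypothesis says [y j <= C * sup_k (w j k * x k)]; bounding the supremum
   by the l_r norm makes the double sum additive, also when [r < 1]. *)
Lemma lq_schur q (w : int -> int -> R) x y (B C : R) :
  (0 < q)%E -> 0 < B -> 0 < C -> (forall k, 0 <= x k) -> (forall k, 0 <= y k) ->
  (forall j k, 0 <= w j k <= 1) ->
  (forall r, q = r%:E -> forall k, (\esum_(j in [set: int]) (w j k `^ r)%:E <= B%:E)%E) ->
  (forall j S, 0 <= S -> (forall k, w j k * x k <= S) -> y j <= C * S) ->
  (lq q y <= (C * B `^ recip q)%:E * lq q x)%E.
Proof.
move=> q0 B0 C0 x0 y0 w01 wB hy.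
have wx0 j k : 0 <= w j k * x k by rewrite mulr_ge0//; case/andP: (w01 j k).
have wx j k : w j k * x k <= x k by rewrite ler_piMl//; case/andP: (w01 j k).
case: q q0 wB => [r| |]//=; last first.
  move=> _ _; rewrite powRr0 mulr1; apply: ge_ereal_sup => _ [j _ <-].
  set s := ereal_sup _.
  have xs k : ((x k)%:E <= s)%E by apply: ereal_sup_ubound; exists k.
  have s0 : (0 <= s)%E by apply: le_trans (xs 0); rewrite lee_fin.
  move: s s0 xs => [s| |]// s0 xs; last by rewrite gt0_muley ?leey.
  rewrite -EFinM lee_fin; apply: hy => // k.
  by apply: le_trans (wx j k) _; rewrite -lee_fin.
rewrite lte_fin => r0 /(_ _ erefl) wB.
have e0 (z : int -> R) : (0 <= \esum_(k in [set: int]) (z k `^ r)%:E)%E.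
  by apply: esum_ge0 => k _; rewrite lee_fin powR_ge0.
set X := (X in (_ * X `^ _)%E).
have [->|Xy] := eqVneq X +oo%E.
  rewrite poweRyr ?invr_eq0 ?gt_eqF// gt0_muley ?leey//.
  by rewrite lte_fin mulr_gt0 ?powR_gt0.
have Xfin : X \is a fin_num by rewrite ge0_fin_numE ?ltey// e0.
have leX j : (\esum_(k in [set: int]) ((w j k * x k) `^ r)%:E <= X)%E.
  apply: le_esum => k _; rewrite lee_fin.
  by apply: ge0_ler_powR; rewrite ?nnegrE ?(ltW r0).
have yj j : ((y j `^ r)%:E <=
    (C `^ r)%:E * \esum_(k in [set: int]) ((w j k * x k) `^ r)%:E)%E.
  set S := esum _ _.
  have Sfin : S \is a fin_num.
    by rewrite ge0_fin_numE ?e0//; apply: le_lt_trans (leX j) _; rewrite ltey.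
  have S0 : 0 <= fine S by rewrite fine_ge0 ?e0.
  have := hy j (fine S `^ r^-1) (powR_ge0 _ _).
  have wS k : w j k * x k <= fine S `^ r^-1.
    have : (((w j k * x k) `^ r)%:E <= S)%E.
      by apply: (@esum_ge _ _ _ (fun k => ((w j k * x k) `^ r)%:E));
        exists [set k] => //; rewrite fsbig_set1.
    rewrite -(fineK Sfin) lee_fin => /(@ge0_ler_powR _ r^-1).
    rewrite !nnegrE powR_ge0 S0 invr_ge0 (ltW r0) -powRrM mulfV ?gt_eqF//.
    by rewrite powRr1//; apply.
  move=> /(_ wS) yC; rewrite -(fineK Sfin) -EFinM lee_fin.
  have -> : fine S = (fine S `^ r^-1) `^ r.
    by rewrite -powRrM mulVf ?gt_eqF// powRr1.
  rewrite -powRM ?powR_ge0 ?(ltW C0)//.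
  by apply: ge0_ler_powR; rewrite ?nnegrE ?mulr_ge0 ?powR_ge0// ltW.
rewrite ge0_poweRV_le ?e0// ?mule_ge0 ?poweR_ge0 ?lee_fin ?mulr_ge0 ?powR_ge0 ?(ltW C0)//.
rewrite poweRM ?poweR_ge0 ?lee_fin ?mulr_ge0 ?powR_ge0 ?(ltW C0)//.
rewrite -poweRrM mulVf ?gt_eqF// poweRe1 ?e0// poweR_EFin.
rewrite powRM ?powR_ge0 ?(ltW C0)// -powRrM mulVf ?gt_eqF// powRr1 ?(ltW B0)//.
apply: le_trans; first by apply: le_esum => j _; exact: yj.
apply: le_trans; first by apply: esumZ_le => [|j]; [exact: powR_ge0|exact: e0].
rewrite EFinM -muleA; apply: lee_wpmul2l; first by rewrite lee_fin powR_ge0.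
(* Summing over [j] first leaves the column sums of the kernel, which are at most [B]. *)
rewrite esum_swap; last by move=> *; rewrite lee_fin powR_ge0.
apply: le_trans (esumZ_le _ _ _); last 2 first.
- exact: ltW.
- by move=> k; rewrite lee_fin powR_ge0.
apply: le_esum => k _; rewrite -EFinM mulrC EFinM.
apply: (@le_trans _ _ ((x k `^ r)%:E * \esum_(i in [set: int]) (w i k `^ r)%:E)%E).
  apply: le_trans (esumZ_le _ _ _); last 2 first.
  - exact: powR_ge0.
  - by move=> j; rewrite lee_fin powR_ge0.
  apply: le_esum => j _; rewrite -EFinM mulrC powRM//.
  by case/andP: (w01 j k).
by apply: lee_wpmul2l; rewrite ?lee_fin ?powR_ge0.
Qed.

End sequence_norm.

(** * Exponentially decaying kernels *)

Section kernel.
Context (R : realType).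
Implicit Types (q : \bar R) (D : set R) (tau : int -> R).

Lemma geometric_sum_le (z : R) : 0 <= z < 1 ->
  (\sum_(0 <= n <oo) (z ^+ n)%:E <= ((1 - z)^-1)%:E)%E.
Proof.
move=> /andP[z0 z1]; apply: lime_le.
  by apply: is_cvg_nneseries => n _ _; rewrite lee_fin exprn_ge0.
apply: nearW => n; rewrite sumEFin lee_fin.
suff -> : \sum_(0 <= i < n) z ^+ i = (1 - z ^+ n) / (1 - z).
  by rewrite ler_pdivrMr ?subr_gt0// mulVf ?gt_eqF ?subr_gt0// lerBlDr lerDl exprn_ge0.
elim: n => [|n IH]; first by rewrite big_nil expr0 subrr mul0r.
by rewrite big_nat_recr//= IH exprSr; field; rewrite subr_eq0 gt_eqF.
Qed.

Lemma two_sided_geometric_sum (eps : R) : 0 < eps ->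
  exists2 B : R, 0 < B & forall i0 : int,
    (\esum_(k in [set: int]) (expR (- eps * `|(k - i0)%:~R|))%:E <= B%:E)%E.
Proof.
move=> e0; pose z : R := expR (- (eps / 2)).
have z1 : z < 1 by rewrite expR_lt1 oppr_lt0 divr_gt0.
exists (1 - z)^-1 => [|i0]; first by rewrite invr_gt0 subr_gt0.
have [zf zi zs] := zenum_bij.
rewrite (reindex_esum setT _ (fun n => zenum n + i0)); last first.
  split => // [m n mT nT /addIr|k _]; first exact: zi.
  have [//|n _ nk] := zs (k - i0) _.
  by exists n => //; rewrite nk subrK.
apply: (@le_trans _ _ (\esum_(n in [set: nat]) (z ^+ n)%:E)); last first.
  rewrite -nneseries_esumT => [|n]; last by rewrite lee_fin exprn_ge0 ?expR_ge0.
  by apply: geometric_sum_le; rewrite z1 expR_ge0.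
(* The n-th integer of the enumeration has absolute value at least n/2, which is why [z] is built
   with [eps / 2]. *)
have key n : (n%:R : R) <= 2 * `|(zenum n)%:~R|.
  rewrite -intr_norm -[n%:R]/((Posz n)%:~R) -[2]/(2%:~R) -intrM ler_int.
  by rewrite /zenum; have := odd_double_half n; case: (odd n) => /= nE; lia.
apply: le_esum => n _; rewrite lee_fin /z -expRM_natl ler_expR addrK.
by have := key n; nra.
Qed.

(** The sequence [tau] grows linearly only up to the defect [c] and need not be monotone. Starting
    from an index where [tau] is at most [s], the crossing is the step just before the first index
    at which [tau] exceeds [s]. *)
Lemma crossing_index tau (al c : R) : 0 < al ->
  (forall i j, i <= j -> al * (j - i)%:~R - c <= tau j - tau i) ->
  forall s, exists i, tau i <= s < tau (i + 1).
Proof.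
move=> al0 tauP s.
(* Growth from [- N] to 0 gives tau(-N) <= tau(0) + c - al N, and [N] is large enough for this to be
   at most [s]. *)
pose N := (Num.truncn (`|tau 0 - s + c| / al)).+1.
have NP : `|tau 0 - s + c| < al * N%:R.
  by rewrite mulrC -ltr_pdivrMr// truncnS_gt.
have hN : tau (- N%:Z) <= s.
  have := tauP (- N%:Z) 0 ltac:(lia).
  rewrite sub0r opprK -[(_ N)%:~R]/(N%:R : R).
  by move: NP; rewrite ltr_norml => /andP[]; lra.
have hM : exists m : nat, s < tau (m%:Z - N%:Z).
  pose M := (Num.truncn (`|s - tau (- N%:Z) + c| / al)).+1.
  have MP : `|s - tau (- N%:Z) + c| < al * M%:R.
    by rewrite mulrC -ltr_pdivrMr// truncnS_gt.
  exists M; have := tauP (- N%:Z) (M%:Z - N%:Z) ltac:(lia).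
  rewrite (_ : _ - _ = M%:Z); last by lia.
  rewrite -[(_ M)%:~R]/(M%:R : R).
  by move: MP; rewrite ltr_norml => /andP[]; lra.
case: (ex_minnP hM) => -[|m] mP mmin.
  by move: mP; rewrite sub0r ltNge hN.
exists (m%:Z - N%:Z); rewrite (_ : _ + 1 = m.+1%:Z - N%:Z); last by lia.
by rewrite mP andbT leNgt; apply/negP => /mmin; rewrite ltnn.
Qed.

(** If [tau] crosses [s] at [i], growth on both sides of [i] gives |s - tau k| >= al |k - i| - c -
    al, and the sum is dominated by a two-sided geometric series. The bound depends neither on [tau]
    nor on [s]. *)
Lemma kernel_sum (al c del : R) : 0 < al -> 0 < del -> 0 <= c ->
  exists2 B : R, 0 < B & forall tau,
    (forall i j, i <= j -> al * (j - i)%:~R - c <= tau j - tau i) ->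
    forall s, (\esum_(k in [set: int]) (expR (- del * `|s - tau k|))%:E <= B%:E)%E.
Proof.
move=> al0 del0 c0.
have [B B0 hB] := two_sided_geometric_sum (mulr_gt0 del0 al0).
exists (expR (del * (c + al)) * B) => [|tau tauP s].
  by rewrite mulr_gt0 ?expR_gt0.
have [i /andP[i1 i2]] := crossing_index al0 tauP s.
apply: (@le_trans _ _ (\esum_(k in [set: int])
    ((expR (del * (c + al)))%:E * (expR (- (del * al) * `|(k - i)%:~R|))%:E)%E)).
  apply: le_esum => k _; rewrite -EFinM lee_fin -expRD ler_expR.
  suff : al * `|(k - i)%:~R| - c - al <= `|s - tau k| by nra.
  have [ki|ik] := leP k i.
    have := tauP k i ki; rewrite ler0_norm; last by rewrite lerz0 subr_le0.
    rewrite -rmorphN opprB => h; apply: le_trans (ler_norm _).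
    by lra.
  have := tauP (i + 1) k; rewrite gtr0_norm; last by rewrite ltr0z subr_gt0.
  rewrite lezD1 => /(_ ik) h; rewrite distrC; apply: le_trans (ler_norm _).
  by move: h; rewrite !intrB intrD; lra.
apply: le_trans; first by apply: esumZ_le => [|k]; rewrite ?lee_fin ?expR_ge0.
by rewrite EFinM; apply: lee_wpmul2l; rewrite ?lee_fin ?expR_ge0.
Qed.

(** A bump that decays exponentially on the logarithmic scale has a norm bounded independently of
    its centre [s], because its samples form a kernel sum. *)
Lemma Lqnorm_decay q (eps : R) : (0 < q)%E -> 0 < eps ->
  exists2 B : R, 0 < B & forall D (f : R -> \bar R) (M s : R), 0 <= M ->
    D `<=` `]0, +oo[ -> (forall u, D u -> (0 <= f u)%E) ->
    (forall u, D u ->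
      (f u <= (M * u `^ (- recip q) * expR (- eps * `|ln u - s|))%:E)%E) ->
    (Lqnorm q D f <= (B * M)%:E)%E.
Proof.
(* The extra [eps] in the exponent absorbs the distance, at most 1, between [ln u] and its integer
   part. *)
move=> q0 e0; pose x s k : R := expR (eps - eps * `|s - k%:~R|).
have x0 s k : 0 <= x s k by exact: expR_ge0.
have [B B0 hB] : exists2 B : R, 0 < B & forall s, (lq q (x s) <= B%:E)%E.
  case: q q0 => [r| |]//; last first.
    move=> _; exists (expR eps) => [|s]; first exact: expR_gt0.
    apply: ge_ereal_sup => _ [k _ <-].
    by rewrite lee_fin /x ler_expR gerBl mulr_ge0// ltW.
  rewrite lte_fin => r0.
  have [B B0 hB] := @kernel_sum 1 0 (eps * r) ltr01 (mulr_gt0 e0 r0) (lexx _).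
  exists ((expR (eps * r) * B) `^ r^-1) => [|s].
    by rewrite powR_gt0 ?mulr_gt0 ?expR_gt0.
  have B'0 : 0 <= expR (eps * r) * B by rewrite mulr_ge0 ?expR_ge0 ?ltW.
  rewrite /lq ge0_poweRV_le ?lee_fin ?powR_ge0//; last first.
    by apply: esum_ge0 => k _; rewrite lee_fin powR_ge0.
  rewrite poweR_EFin -powRrM mulVf ?gt_eqF// powRr1//.
  apply: (@le_trans _ _ ((expR (eps * r))%:E *
    \esum_(k in [set: int]) (expR (- (eps * r) * `|s - k%:~R|))%:E)%E).
    apply: le_trans (esumZ_le _ _ _); last 2 first.
    - exact: expR_ge0.
    - by move=> k; rewrite lee_fin expR_ge0.
    apply: le_esum => k _; rewrite -EFinM lee_fin -expRD.
    by rewrite powRE ?expR_gt0// expRK ler_expR; lra.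
  rewrite EFinM; apply: lee_wpmul2l; first by rewrite lee_fin expR_ge0.
  by apply: hB => i j _; rewrite mul1r subr0 intrB.
pose C := expR (recip q) * B.
have C0 : 0 < C by rewrite mulr_gt0 ?expR_gt0.
exists C => // D f M s + D0 f0.
have pos M' : 0 < M' -> (forall u, D u ->
      (f u <= (M' * u `^ (- recip q) * expR (- eps * `|ln u - s|))%:E)%E) ->
    (Lqnorm q D f <= (C * M')%:E)%E.
  move=> M0 fM.
  pose g u : \bar R := (u `^ (- recip q) * expR (- eps * `|ln u - s|))%:E.
  apply: (@le_trans _ _ (Lqnorm q D (fun u => M'%:E * g u)%E)).
    apply: le_Lqnorm => // u Du; apply: le_trans (fM u Du) _.
    by rewrite -EFinM lee_fin mulrA.
  rewrite LqnormZ// mulrC EFinM; apply: lee_wpmul2l.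
    by rewrite lee_fin ltW.
  have := @Lqnorm_le_lq _ q D g _ q0 D0 _ (x0 s) _.
  rewrite /C EFinM => /(_ _ _)/le_trans; apply.
  - by move=> u _; rewrite lee_fin mulr_ge0 ?powR_ge0 ?expR_ge0.
  - move=> u _; rewrite lee_fin ler_wpM2l ?powR_ge0// /x ler_expR.
    have := ln_floor u; set k := (Num.floor _)%:~R => /andP[k1 k2].
    have : `|s - k| <= `|ln u - s| + 1.
      have -> : s - k = - (ln u - s) + (ln u - k) by ring.
      apply: le_trans (ler_normD _ _) _; rewrite normrN lerD2l ger0_norm; lra.
    by nra.
  - by apply: lee_wpmul2l; rewrite ?lee_fin ?expR_ge0.
rewrite le_eqVlt => /predU1P[<- fM|]; last exact: pos.
(* Homogeneity is available for positive factors, so [M = 0] is reached through arbitrarily small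
   positive bounds. *)
rewrite mulr0; apply/lee_addgt0Pr => e e1; rewrite add0e.
rewrite -[e](@mulVKf _ C) ?gt_eqF//; apply: pos => [|u Du].
  by rewrite mulr_gt0 ?invr_gt0.
apply: le_trans (fM u Du) _; rewrite !mul0r lee_fin.
by rewrite !mulr_ge0 ?powR_ge0 ?expR_ge0 ?invr_ge0 ?(ltW C0) ?(ltW e1).
Qed.

End kernel.

(** * Slowly varying functions *)

Section slowly_varying.
Context (R : realType).
Implicit Types (b : R -> R) (q : \bar R).

(* Potter's bounds, on a logarithmic scale. *)
Definition log_slow b := forall eps, 0 < eps -> exists2 C : R, 0 <= C &
  forall s t, 0 < s -> 0 < t -> ln (b s) - ln (b t) <= C + eps * `|ln s - ln t|.

(** Turns monotonicity up to equivalence into an additive inequality between logarithms: f(s) <= C1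
    g(s) <= C1 g(t) <= C1 C2 f(t). *)
Lemma equivalent_ln (f g : R -> R) : positive_on_half_line f ->
  positive_on_half_line g -> equivalent f g ->
  exists C, forall s t, 0 < s -> 0 < t -> g s <= g t -> ln (f s) <= C + ln (f t).
Proof.
move=> f0 g0 [[C1 h1] [C2 h2]].
have C10 : 0 < C1.
  rewrite ltNge; apply/negP => C1n; have := h1 1 ltr01.
  by have := f0 1 ltr01; have := g0 1 ltr01; nra.
have C20 : 0 < C2.
  rewrite ltNge; apply/negP => C2n; have := h2 1 ltr01.
  by have := f0 1 ltr01; have := g0 1 ltr01; nra.
exists (ln (C1 * C2)) => s t s0 t0 st.
have [fs ft] := (f0 s s0, f0 t t0).
rewrite -lnM ?posrE ?mulr_gt0// ler_ln ?posrE ?mulr_gt0//.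
apply: le_trans (h1 s s0) _; rewrite -mulrA ler_wpM2l ?(ltW C10)//.
by apply: le_trans st _; exact: h2.
Qed.

(** The almost increasing function t^eps b(t) gives the estimate for s <= t, and the almost
    decreasing t^(-eps) b(t) gives it for t < s. *)
Lemma SV_log_slow b : SV b -> log_slow b.
Proof.
move=> [b0 _ bi bd] eps e0.
have pb p : positive_on_half_line (fun t => t `^ p * b t).
  by move=> t t0; rewrite mulr_gt0 ?powR_gt0// b0.
have lnpb p t : 0 < t -> ln (t `^ p * b t) = p * ln t + ln (b t).
  by move=> t0; rewrite lnM ?posrE ?powR_gt0 ?b0// ln_powR.
have [g [g0 geq ginc]] := bi eps e0.
have [h [h0 heq hdec]] := bd eps e0.
have [C1 P1] := equivalent_ln (pb _) g0 geq.
have [C2 P2] := equivalent_ln (pb _) h0 heq.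
exists (`|C1| + `|C2|) => [|s t s0 t0]; first by rewrite addr_ge0.
have C1a := ler_norm C1; have C2a := ler_norm C2.
have [C1p C2p] := (normr_ge0 C1, normr_ge0 C2).
have [st|ts] := leP s t.
  have := P1 s t s0 t0 (ginc s t s0 st); rewrite !lnpb//.
  rewrite (@ler0_norm _ (ln s - ln t)); first by lra.
  by rewrite subr_le0 ler_ln.
have := P2 s t s0 t0 (hdec t s t0 (ltW ts)); rewrite !lnpb//.
rewrite (@ger0_norm _ (ln s - ln t)); first by lra.
by rewrite subr_ge0 ler_ln// ltW.
Qed.

Lemma log_slowM b c : positive_on_half_line b -> positive_on_half_line c ->
  log_slow b -> log_slow c -> log_slow (fun t => b t * c t).
Proof.
move=> b0 c0 hb hc eps e0.
have [C1 C10 h1] := hb (eps / 2) (divr_gt0 e0 (ltr0Sn _ _)).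
have [C2 C20 h2] := hc (eps / 2) (divr_gt0 e0 (ltr0Sn _ _)).
exists (C1 + C2) => [|s t s0 t0]; first exact: addr_ge0.
have := h1 s t s0 t0; have := h2 s t s0 t0.
by rewrite !lnM ?posrE ?b0 ?c0//; lra.
Qed.

Lemma log_slowV b : positive_on_half_line b ->
  log_slow b -> log_slow (fun t => (b t)^-1).
Proof.
move=> b0 hb eps e0; have [C C0 h] := hb eps e0.
exists C => // s t s0 t0; have := h t s t0 s0.
by rewrite distrC !lnV ?posrE ?b0//; lra.
Qed.

End slowly_varying.

(** * The norm of a slowly varying weight over (0, t) *)

Section primitive.
Context (R : realType) (r : \bar R) (b : R -> R).
Hypotheses (r0 : (0 < r)%E) (b0 : positive_on_half_line b) (hb : log_slow b).
Let Lam t := Lqnorm r `]0, t[ (fun s => (s `^ (- recip r) * b s)%:E).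
Hypothesis Lam1 : (Lam 1 < +oo)%E.
Let L t := fine (Lam t).

Lemma le_Lam s t : s <= t -> (Lam s <= Lam t)%E.
Proof.
move=> st; apply: le_Lqnorm => // u /=; rewrite !in_itv /= => /andP[u0 us].
  by rewrite u0 (lt_le_trans us).
by rewrite lee_fin mulr_ge0 ?powR_ge0// ltW// b0.
Qed.

(** The interval (0, u) is split at [t], and slow variation controls the weight beyond [t]. The real
    bound [M] lets the lemma serve both for the finiteness of [Lam] beyond 1 and for the slow
    variation of [L]. *)
Lemma Lam_growth eps : 0 < eps -> exists2 C : R, 0 < C &
  forall t u (M : R), 0 < t -> t <= u -> 0 <= M -> (Lam t <= M%:E)%E -> b t <= M ->
  (Lam u <= (C * M * expR (eps * (ln u - ln t)))%:E)%E.
Proof.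
move=> e0; have e20 : 0 < eps / 2 by rewrite divr_gt0.
have [C C0 hC] := hb e20.
have [B B0 hB] := Lqnorm_decay r0 e20.
pose K := 1 + B * expR C.
have K0 : 0 < K by rewrite addr_gt0 ?mulr_gt0 ?expR_gt0.
exists (2 `^ recip r * K) => [|t u M t0 tu M0 tM bM].
  by rewrite mulr_gt0 ?powR_gt0.
set E := expR _.
have lntu : ln t <= ln u by rewrite ler_ln ?posrE// (lt_le_trans t0).
have E1 : 1 <= E by rewrite -expR0 ler_expR mulr_ge0 ?subr_ge0// ltW.
have -> : Lam u = Lqnorm r (`]0, t[ `|` `[t, u[) (fun s => (s `^ (- recip r) * b s)%:E).
  by rewrite -itv_bndbnd_setU ?bnd_simp// ltW.
rewrite -!mulrA; apply: LqnormU_le => //.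
- by rewrite mulr_ge0 ?(ltW K0)// mulr_ge0 ?expR_ge0.
- apply: le_trans tM _; rewrite lee_fin -[leLHS]mul1r ler_pM//.
    by rewrite lerDl mulr_ge0 ?expR_ge0 ?(ltW B0).
  by rewrite ler_peMr.
have ME0 : 0 <= M * expR C * E by rewrite !mulr_ge0 ?expR_ge0.
(* Slow variation with [eps / 2] lets b(s) grow like (s/t)^(eps/2). Since s < u, this is at most
   (u/t)^eps (s/t)^(-eps/2), a decaying bump centred at [ln t]. *)
apply: le_trans (hB _ _ (M * expR C * E) (ln t) ME0 _ _ _) _.
- by move=> s /=; rewrite !in_itv /= andbT => /andP[ts _]; exact: lt_le_trans ts.
- move=> s /=; rewrite in_itv /= => /andP[ts _].
  by rewrite lee_fin mulr_ge0 ?powR_ge0// ltW// b0// (lt_le_trans t0).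
- move=> s /=; rewrite in_itv /= => /andP[ts su].
  have s0 : 0 < s by exact: lt_le_trans ts.
  rewrite lee_fin [leRHS]mulrAC [leRHS]mulrC ler_wpM2l ?powR_ge0//.
  have := hC s t s0 t0.
  have lts : ln t <= ln s by rewrite ler_ln.
  have lsu : ln s <= ln u by rewrite ler_ln ?posrE ?ltW// (lt_trans s0).
  rewrite ger0_norm ?subr_ge0// => h.
  apply: (@le_trans _ _ (b t * expR (C + eps / 2 * (ln s - ln t)))).
    by rewrite -[leLHS]lnK ?posrE ?b0// -[b t]lnK ?posrE ?b0// -expRD ler_expR; lra.
  rewrite -!mulrA ler_pM ?expR_ge0 ?(ltW (b0 _))// -!expRD ler_expR.
  by nra.
rewrite lee_fin (_ : B * _ = (B * expR C) * (M * E)); last by ring.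
by rewrite ler_wpM2r ?mulr_ge0 ?expR_ge0// lerDr.
Qed.

(** The interval (t/e, t) alone contributes a multiple of b(t), since [b] is comparable to b(t)
    there. *)
Lemma weight_le_Lam : exists2 C : R, 0 < C & forall t, 0 < t -> ((C * b t)%:E <= Lam t)%E.
Proof.
have [C C0 hC] := hb ltr01.
exists (2 `^ (- recip r) * expR (- C - 1)) => [|t t0].
  by rewrite mulr_gt0 ?powR_gt0 ?expR_gt0.
rewrite -mulrA; have tE : expR 1 * (t / expR 1) = t by field; rewrite gt_eqF ?expR_gt0.
apply: (@Lqnorm_ge _ _ _ _ (t / expR 1)) => //.
- by rewrite divr_gt0 ?expR_gt0.
- by rewrite mulr_ge0 ?expR_ge0// ltW// b0.
- rewrite tE => u /=; rewrite !in_itv /= => /andP[su ->]; rewrite andbT.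
  by apply: lt_trans su; rewrite divr_gt0 ?expR_gt0.
rewrite tE => u /andP[su ut].
have s0 : 0 < t / expR 1 by rewrite divr_gt0 ?expR_gt0.
have u0 : 0 < u by exact: lt_trans su.
rewrite lee_fin mulrC ler_wpM2l ?powR_ge0//.
have lut : ln u <= ln t by rewrite ler_ln ?posrE// ltW.
have ltu : ln t - 1 <= ln u.
  by rewrite -[X in _ - X]expRK -ln_div ?posrE ?expR_gt0// ler_ln ?posrE// ltW.
have := hC t u t0 u0; rewrite ger0_norm ?subr_ge0// => h.
rewrite -[b t]lnK ?posrE ?b0// -[b u]lnK ?posrE ?b0// -expRD ler_expR.
by lra.
Qed.

Lemma Lam_fin t : 0 < t -> Lam t = (L t)%:E.
Proof.
move=> t0; rewrite /L fineK// ge0_fin_numE ?Lqnorm_ge0//.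
have [t1|/ltW t1] := leP t 1; first exact: le_lt_trans (le_Lam t1) Lam1.
have [C C0 hC] := Lam_growth ltr01.
have L1 : Lam 1 = (fine (Lam 1))%:E by rewrite fineK// ge0_fin_numE ?Lqnorm_ge0.
apply: le_lt_trans (hC 1 t (Num.max (fine (Lam 1)) (b 1)) ltr01 t1 _ _ _) (ltry _).
- by rewrite le_max [X in _ || X]ltW ?orbT// b0.
- by rewrite [leLHS]L1 lee_fin le_max lexx.
- by rewrite le_max lexx orbT.
Qed.

Lemma L_gt0 t : 0 < t -> 0 < L t.
Proof.
move=> t0; have [C C0 hC] := weight_le_Lam.
have := hC t t0; rewrite Lam_fin// lee_fin; apply: lt_le_trans.
by rewrite mulr_gt0// b0.
Qed.

Lemma le_L s t : 0 < s -> s <= t -> L s <= L t.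
Proof.
move=> s0 st; rewrite -lee_fin -!Lam_fin ?le_Lam//.
exact: lt_le_trans st.
Qed.

Lemma weight_le_L : exists2 C : R, 0 <= C & forall t, 0 < t -> ln (b t) <= C + ln (L t).
Proof.
have [C C0 hC] := weight_le_Lam.
exists `|ln C| => // t t0; have := hC t t0; rewrite Lam_fin// lee_fin => h.
have [Lt0 bt0] := (L_gt0 t0, b0 t0).
move: h; rewrite -(ler_ln (x := C * b t) (y := L t)) ?posrE ?mulr_gt0// lnM ?posrE// => h.
have := ler_norm (- ln C); rewrite normrN; lra.
Qed.

(** As [L] is nondecreasing, only t <= s needs an argument. There [Lam_growth] applies with a
    multiple of L(t) as [M], because L(t) also dominates b(t). *)
Lemma log_slow_L : log_slow L.
Proof.
move=> eps e0; have [C C0 hC] := Lam_growth e0.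
have [D D0 hD] := weight_le_L.
pose K := Num.max 0 (ln (C * (1 + expR D))).
have K0 : 0 <= K by rewrite le_max lexx.
have C1 : 0 < C * (1 + expR D) by rewrite mulr_gt0// addr_gt0 ?expR_gt0.
exists K => // s t s0 t0.
have [Ls Lt] := (L_gt0 s0, L_gt0 t0).
have [st|/ltW ts] := leP s t.
  have : ln (L s) <= ln (L t) by rewrite ler_ln// le_L.
  by have := mulr_ge0 (ltW e0) (normr_ge0 (ln s - ln t)); lra.
have lts : ln t <= ln s by rewrite ler_ln.
rewrite ger0_norm ?subr_ge0//.
have M0 : 0 <= (1 + expR D) * L t by rewrite mulr_ge0 ?addr_ge0 ?expR_ge0// ltW.
have := hC t s _ t0 ts M0 _ _; rewrite !Lam_fin// !lee_fin.
have tM : L t <= (1 + expR D) * L t by rewrite ler_peMl ?(ltW Lt)// lerDl expR_ge0.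
have bM : b t <= (1 + expR D) * L t.
  rewrite mulrDl mul1r; apply: le_trans (_ : expR D * L t <= _); last first.
    by rewrite lerDr ltW.
  by rewrite -[b t]lnK ?posrE ?b0// -[L t]lnK ?posrE// -expRD ler_expR hD.
move=> /(_ tM bM); rewrite mulrA.
rewrite -ler_ln ?posrE ?mulr_gt0 ?expR_gt0 ?addr_gt0 ?expR_gt0//.
rewrite lnM ?posrE ?expR_gt0 ?mulr_gt0 ?addr_gt0 ?expR_gt0// expRK lnM ?posrE//.
have : ln (C * (1 + expR D)) <= K by rewrite le_max lexx orbT.
by lra.
Qed.

End primitive.

(** * K-functionals *)

Section Kfunctional.
Context (R : realType) (V : lmodType R).
Implicit Types (f g : V) (t : R).

(** Outside the sum space [Kfun] is [+oo], which [fine] turns into 0, so this real-valued form is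
    meaningful only on the sum space. *)
Definition Kfin (X0 X1 : qspace V) t f : R := fine (Kfun X0 X1 t f).

Definition nonneg_norm (X0 : qspace V) := forall x, carrier X0 x -> 0 <= qnorm X0 x.

Lemma Kfun_le (X0 X1 : qspace V) t f0 f1 : carrier X0 f0 -> carrier X1 f1 ->
  (Kfun X0 X1 t (f0 + f1) <= (qnorm X0 f0 + t * qnorm X1 f1)%:E)%E.
Proof. by move=> h0 h1; apply: ereal_inf_lbound; exists (f0, f1). Qed.

Lemma le_Kfun (X0 X1 : qspace V) t f (m : \bar R) :
  (forall f0 f1, carrier X0 f0 -> carrier X1 f1 -> f = f0 + f1 ->
     (m <= (qnorm X0 f0 + t * qnorm X1 f1)%:E)%E) ->
  (m <= Kfun X0 X1 t f)%E.
Proof. by move=> h; apply: le_ereal_inf_tmp => _ [[f0 f1] [h0 h1 fE] <-]; exact: h. Qed.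

Section monotonicity.
Variables (X0 X1 : qspace V).
Hypotheses (n0 : nonneg_norm X0) (n1 : nonneg_norm X1).

Lemma Kfun_ge0 t f : 0 <= t -> (0 <= Kfun X0 X1 t f)%E.
Proof.
move=> t0; apply: le_Kfun => f0 f1 h0 h1 _.
by rewrite lee_fin addr_ge0 ?mulr_ge0 ?n0 ?n1.
Qed.

Lemma Kfin_ge0 t f : 0 <= t -> 0 <= Kfin X0 X1 t f.
Proof. by move=> t0; rewrite /Kfin fine_ge0// Kfun_ge0. Qed.

Lemma KfinE t f : 0 <= t -> sum_set X0 X1 f -> Kfun X0 X1 t f = (Kfin X0 X1 t f)%:E.
Proof.
move=> t0 [f0 h0 [f1 h1 <-]]; rewrite /Kfin fineK// ge0_fin_numE ?Kfun_ge0//.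
by apply: le_lt_trans (Kfun_le t h0 h1) _; rewrite ltry.
Qed.

Lemma Kfin_le t f0 f1 : 0 <= t -> carrier X0 f0 -> carrier X1 f1 ->
  Kfin X0 X1 t (f0 + f1) <= qnorm X0 f0 + t * qnorm X1 f1.
Proof.
move=> t0 h0 h1; rewrite -lee_fin -KfinE//; first exact: Kfun_le.
by exists f0 => //; exists f1.
Qed.

Lemma le_Kfin t f (m : R) : 0 <= t -> sum_set X0 X1 f ->
  (forall f0 f1, carrier X0 f0 -> carrier X1 f1 -> f = f0 + f1 ->
     m <= qnorm X0 f0 + t * qnorm X1 f1) ->
  m <= Kfin X0 X1 t f.
Proof.
move=> t0 hf h; rewrite -lee_fin -KfinE//; apply: le_Kfun => f0 f1 h0 h1 fE.
by rewrite lee_fin; exact: h.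
Qed.

Lemma Kfin_approx t f (m : R) : 0 <= t -> sum_set X0 X1 f -> Kfin X0 X1 t f < m ->
  exists f0 f1, [/\ carrier X0 f0, carrier X1 f1, f = f0 + f1 &
    qnorm X0 f0 + t * qnorm X1 f1 < m].
Proof.
move=> t0 hf hm; apply: contrapT => hn.
suff : m <= Kfin X0 X1 t f by rewrite leNgt hm.
apply: le_Kfin => // f0 f1 h0 h1 fE; rewrite leNgt; apply/negP => lm.
by apply: hn; exists f0, f1.
Qed.

(** The usual factor max(1, s/t) is weakened to the exponential of the logarithmic distance, a
    symmetric form that combines with slow variation. *)
Lemma Kfin_comparable s t f : 0 < s -> 0 < t -> sum_set X0 X1 f ->
  Kfin X0 X1 s f <= expR `|ln s - ln t| * Kfin X0 X1 t f.
Proof.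
move=> s0 t0 hf; rewrite -ler_pdivrMl ?expR_gt0//.
apply: le_Kfin => //; first exact: ltW.
move=> f0 f1 h0 h1 fE; rewrite ler_pdivrMl ?expR_gt0//.
have : Kfin X0 X1 s f <= qnorm X0 f0 + s * qnorm X1 f1.
  by rewrite fE Kfin_le// ltW.
move=> /le_trans; apply; rewrite mulrDr lerD//.
  by rewrite ler_peMl ?n0// -expR0 ler_expR.
rewrite mulrA ler_wpM2r ?n1// -[leLHS]lnK ?posrE// -[X in _ * X]lnK ?posrE//.
by rewrite -expRD ler_expR -lerBlDr ler_norm.
Qed.

End monotonicity.

Lemma qnorm0 (X0 : qspace V) : quasi_banach X0 -> qnorm X0 0 = 0.
Proof.
by move=> h; have := qnormZ h 0 (carrier0 h); rewrite scale0r normr0 mul0r.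
Qed.

Lemma qnormN (X0 : qspace V) x : quasi_banach X0 -> carrier X0 x -> qnorm X0 (- x) = qnorm X0 x.
Proof.
by move=> h xX; rewrite -scaleN1r (qnormZ h)// normrN normr1 mul1r.
Qed.

Lemma carrierN (X0 : qspace V) x : quasi_banach X0 -> carrier X0 x -> carrier X0 (- x).
Proof. by move=> h xX; rewrite -scaleN1r; exact: carrierZ. Qed.

Section quasi_triangle.
Variables (X0 X1 : qspace V).
Hypotheses (h0 : quasi_banach X0) (h1 : quasi_banach X1).

Lemma sum_setD f g : sum_set X0 X1 f -> sum_set X0 X1 g -> sum_set X0 X1 (f + g).
Proof.
move=> [f0 f0X [f1 f1X <-]] [g0 g0X [g1 g1X <-]].
exists (f0 + g0); first exact: carrierD.
by exists (f1 + g1); [exact: carrierD|rewrite addrACA].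
Qed.

Lemma sum_set_fst f : carrier X0 f -> sum_set X0 X1 f.
Proof. by move=> fX; exists f => //; exists 0; [exact: carrier0|rewrite addr0]. Qed.

Lemma sum_set_snd f : carrier X1 f -> sum_set X0 X1 f.
Proof. by move=> fX; exists 0; [exact: carrier0|exists f => //; rewrite add0r]. Qed.

Lemma Kfin_fst t f : 0 <= t -> carrier X0 f -> Kfin X0 X1 t f <= qnorm X0 f.
Proof.
move=> t0 fX; rewrite -[f in leLHS]addr0.
apply: le_trans (Kfin_le (qnorm_ge0 h0) (qnorm_ge0 h1) t0 fX (carrier0 h1)) _.
by rewrite (qnorm0 h1) mulr0 addr0.
Qed.

Lemma Kfin_snd t f : 0 <= t -> carrier X1 f -> Kfin X0 X1 t f <= t * qnorm X1 f.
Proof.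
move=> t0 fX; rewrite -[f in leLHS]add0r.
apply: le_trans (Kfin_le (qnorm_ge0 h0) (qnorm_ge0 h1) t0 (carrier0 h0) fX) _.
by rewrite (qnorm0 h0) add0r.
Qed.

Lemma KfinD : exists2 C : R, 1 <= C & forall t f g, 0 <= t ->
  sum_set X0 X1 f -> sum_set X0 X1 g ->
  Kfin X0 X1 t (f + g) <= C * (Kfin X0 X1 t f + Kfin X0 X1 t g).
Proof.
have [C0 hC0] := qnormD h0; have [C1 hC1] := qnormD h1.
(* The maximum with 1 makes the constant positive, so that it can be moved to the other side before
   the two infima are taken one after the other. *)
pose C := Num.max 1 (Num.max C0 C1).
have C1' : 1 <= C by rewrite le_max lexx.
have Cp : 0 < C by exact: lt_le_trans C1'.
have C0C : C0 <= C by rewrite !le_max lexx orbT.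
have C1C : C1 <= C by rewrite !le_max lexx !orbT.
have [p0 p1] := (qnorm_ge0 h0, qnorm_ge0 h1).
exists C => // t f g t0 hf hg; rewrite -ler_pdivrMl// -lerBlDr.
apply: le_Kfin => // f0 f1 f0X f1X fE; rewrite lerBlDr -lerBlDl.
apply: le_Kfin => // g0 g1 g0X g1X gE; rewrite lerBlDl ler_pdivrMl//.
have -> : f + g = (f0 + g0) + (f1 + g1) by rewrite fE gE addrACA.
apply: le_trans (Kfin_le p0 p1 t0 (carrierD h0 f0X g0X) (carrierD h1 f1X g1X)) _.
rewrite [X in _ <= C * X](_ : _ = (qnorm X0 f0 + qnorm X0 g0) +
  t * (qnorm X1 f1 + qnorm X1 g1)); last by ring.
rewrite mulrDr lerD//.
  by apply: le_trans (hC0 _ _ f0X g0X) _; rewrite ler_wpM2r ?addr_ge0 ?p0.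
rewrite mulrCA ler_wpM2l//.
by apply: le_trans (hC1 _ _ f1X g1X) _; rewrite ler_wpM2r ?addr_ge0 ?p1.
Qed.

End quasi_triangle.
End Kfunctional.

(** * The K-functional of the couple (A0, X) *)

Section Holmstedt.
Context (R : realType) (V : lmodType R) (A0 A1 : qspace V).
Hypotheses (hA0 : quasi_banach A0) (hA1 : quasi_banach A1).
Variables (sig : R) (q r : \bar R) (a b : R -> R).
Hypotheses (sig0 : 0 < sig) (sig1 : sig < 1) (q0 : (0 < q)%E) (r0 : (0 < r)%E).
Hypotheses (a0 : positive_on_half_line a) (b0 : positive_on_half_line b).
Hypotheses (sa : log_slow a) (sb : log_slow b).

Let w t := b t / a t.
Let Lam t := Lqnorm r `]0, t[ (fun s => (s `^ (- recip r) * w s)%:E).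
Hypothesis Lam1 : (Lam 1 < +oo)%E.
Let L t := fine (Lam t).
Let X := Rspace A0 A1 sig r b q a.
Let N f := Lqnorm r `]0, +oo[
    (fun t => (t `^ (- recip r) * (b t / a t))%:E *
       Lqnorm q `]t, +oo[
         (fun u => (u `^ (- sig - recip q) * a u)%:E * Kfun A0 A1 u f))%E.

(* The logarithm of the function [rho] of the theorem. *)
Definition log_rho t := sig * ln t - ln (a t) - ln (L t).

Let w0 : positive_on_half_line w.
Proof. by move=> t t0; rewrite divr_gt0 ?a0 ?b0. Qed.

Let sw : log_slow w.
Proof.
apply: log_slowM => //; last exact: log_slowV.
by move=> t t0; rewrite invr_gt0 a0.
Qed.

Let p0 := qnorm_ge0 hA0.
Let p1 := qnorm_ge0 hA1.
Let K := Kfin A0 A1.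

Lemma log_rho_slow eps : 0 < eps -> exists2 C : R, 0 <= C &
  forall s t, 0 < s -> 0 < t ->
    `|log_rho s - log_rho t - sig * (ln s - ln t)| <= C + eps * `|ln s - ln t|.
Proof.
move=> e0; have e20 : 0 < eps / 2 by rewrite divr_gt0.
have [C C0 hC] := sa e20.
have [D D0 hD] := log_slow_L r0 w0 sw Lam1 e20.
exists (C + D) => [|s t s0 t0]; first exact: addr_ge0.
have := hC s t s0 t0; have := hC t s t0 s0.
have := hD s t s0 t0; have := hD t s t0 s0.
rewrite !(distrC (ln t)) -/(Lam s) -/(Lam t) -/(L s) -/(L t) /log_rho => h1 h2 h3 h4.
by rewrite ler_norml; apply/andP; split; lra.
Qed.

Lemma Rspace_N_lt f : carrier X f -> (N f < +oo)%E. Proof. by case. Qed.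

Lemma NE f : carrier X f -> N f = (qnorm X f)%:E.
Proof. by move=> hf; rewrite /= fineK// ge0_fin_numE ?Lqnorm_ge0//; exact: Rspace_N_lt. Qed.

Lemma X_norm_ge0 : nonneg_norm X.
Proof. by move=> f _; rewrite /= fine_ge0// Lqnorm_ge0. Qed.

Lemma innerE u f : 0 < u -> sum_set A0 A1 f ->
  ((u `^ (- sig - recip q) * a u)%:E * Kfun A0 A1 u f)%E =
  (u `^ (- recip q) * (expR (- sig * ln u + ln (a u)) * K u f))%:E.
Proof.
move=> u0 hf; rewrite KfinE ?(ltW u0)// -EFinM; congr EFin.
rewrite powRD; last by apply/implyP => _; rewrite gt_eqF.
by rewrite (powRE (- sig))// expRD lnK ?posrE ?a0//; rewrite /K; ring.
Qed.

Lemma K_le_norm : exists2 C : R, 0 < C & forall t g, 0 < t -> carrier X g ->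
  K t g <= C * expR (log_rho t) * qnorm X g.
Proof.
have [C C0 hC] := sa ltr01.
(* For t < u < e t, the power u^(-sig), the weight [a] and K(u) each lose at most a factor e, apart
   from the constant e^C of [a]; hence [C + 3]. The power of 2 comes from [Lqnorm_ge]. *)
pose c := 2 `^ (- recip q) * expR (- (C + 3)).
have c0 : 0 < c by rewrite mulr_gt0 ?powR_gt0 ?expR_gt0.
exists c^-1 => [|t g t0 gX]; first by rewrite invr_gt0.
have gS : sum_set A0 A1 g by case: gX.
have [K0|] := eqVneq (K t g) 0.
  rewrite K0 !mulr_ge0 ?expR_ge0 ?X_norm_ge0//.
  by rewrite invr_ge0 ltW.
rewrite neq_lt ltNge Kfin_ge0 ?(ltW t0)//= => K0.
pose m := c * (expR (- sig * ln t + ln (a t)) * K t g).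
have m0 : 0 < m by rewrite !mulr_gt0 ?expR_gt0.
pose J s := Lqnorm q `]s, +oo[ (fun u => (u `^ (- sig - recip q) * a u)%:E * Kfun A0 A1 u g)%E.
have mJ s : 0 < s -> s < t -> (m%:E <= J s)%E.
  move=> s0 st; rewrite /m /c -mulrA; apply: (@Lqnorm_ge _ _ _ _ t) => //.
  - by rewrite !mulr_ge0 ?expR_ge0// ltW.
  - by move=> u /=; rewrite !in_itv /= andbT => /andP[tu _]; exact: lt_trans tu.
  move=> u /andP[tu ut]; have u0 : 0 < u by exact: lt_trans tu.
  rewrite innerE// lee_fin mulrC ler_wpM2l ?powR_ge0//.
  rewrite mulrA -expRD.
  have lut : ln u <= ln t + 1.
    by rewrite addrC -[X in X + _]expRK -lnM ?posrE ?expR_gt0// ler_ln ?posrE ?mulr_gt0 ?expR_gt0// ltW.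
  have ltu : ln t <= ln u by rewrite ler_ln ?posrE// ltW.
  have ltuE : `|ln t - ln u| = ln u - ln t by rewrite distrC ger0_norm ?subr_ge0.
  have := hC t u t0 u0; have := Kfin_comparable p0 p1 t0 u0 gS; rewrite ltuE => hK ha.
  apply: le_trans; first by apply: ler_wpM2l hK; exact: expR_ge0.
  rewrite mulrA -expRD ler_wpM2r ?Kfin_ge0 ?(ltW u0)// ler_expR.
  have : 0 <= (1 - sig) * (ln u - ln t) by rewrite mulr_ge0 ?subr_ge0 ?(ltW sig1).
  by lra.
have ws s : 0 < s -> 0 <= s `^ (- recip r) * w s.
    by move=> s0; apply: mulr_ge0; [exact: powR_ge0|exact/ltW/w0].
(* For every s < t the inner norm is at least [m], so the outer one is at least [m] times the norm
   of the weight over (0, t), which is L(t). *)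
have mN : ((m * L t)%:E <= N g)%E.
  rewrite EFinM -(Lam_fin r0 w0 sw Lam1 t0) -LqnormZ//; apply: le_Lqnorm => //.
  - by move=> s /=; rewrite !in_itv /= andbT => /andP[].
  - move=> s /=; rewrite in_itv /= => /andP[s0 _].
    by apply: mule_ge0; rewrite lee_fin ?(ltW m0) ?ws.
  move=> s /=; rewrite in_itv /= => /andP[s0 st]; rewrite muleC.
  apply: lee_wpmul2l; last exact: mJ.
  by rewrite lee_fin ws.
move: mN; rewrite NE// lee_fin => mN.
rewrite -mulrA ler_pdivlMl// /log_rho.
have Lt := L_gt0 r0 w0 sw Lam1 t0; rewrite -/(Lam t) -/(L t) in Lt.
have -> : sig * ln t - ln (a t) - ln (L t) = - (- sig * ln t + ln (a t) + ln (L t)) by ring.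
rewrite expRN ler_pdivlMl ?expR_gt0// (expRD (_ + _)) lnK ?posrE//.
by apply: le_trans mN; rewrite /m le_eqVlt; apply/orP; left; apply/eqP; ring.
Qed.

(** For f = f0 + g with g in [X], K(t, f0) is at most the norm of f0 and [K_le_norm] bounds K(t, g).
    The infimum over such decompositions gives the claim. *)
Lemma K_le_Krho : exists2 C : R, 0 < C & forall t f, 0 < t -> sum_set A0 X f ->
  K t f <= C * Kfin A0 X (expR (log_rho t)) f.
Proof.
have [C C0 hC] := K_le_norm; have [Q Q1 hQ] := KfinD hA0 hA1.
have Q0 : 0 < Q by exact: lt_le_trans Q1.
exists (Q * (1 + C)) => [|t f t0 hf]; first by rewrite mulr_gt0// addr_gt0.
rewrite -ler_pdivrMl ?mulr_gt0 ?addr_gt0//.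
apply: (le_Kfin p0 X_norm_ge0) => //.
move=> f0 g f0A gX fE; rewrite ler_pdivrMl ?mulr_gt0 ?addr_gt0// fE.
have gS : sum_set A0 A1 g by case: gX.
apply: le_trans (hQ t f0 g (ltW t0) (sum_set_fst hA1 f0A) gS) _.
rewrite -mulrA ler_wpM2l ?(ltW Q0)//.
have h1 := Kfin_fst hA0 hA1 (ltW t0) f0A.
have h2 := hC t g t0 gX; rewrite -mulrA in h2.
have h3 := p0 f0A; have h4 := X_norm_ge0 gX.
have h5 : 0 <= expR (log_rho t) * qnorm X g by rewrite mulr_ge0 ?expR_ge0.
by move: h1 h2 h3 h5; rewrite /K; set x := Kfin _ _ _ _; set y := Kfin _ _ _ _; set z := _ * qnorm X g; nra.
Qed.

(* The hypotheses on [K u g] are the ones satisfied by the second component of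
   a nearly optimal decomposition at [t], see [Krho_le]. *)
Lemma Rspace_N_le eps : 0 < eps -> exists2 C : R, 0 < C & forall t g S,
  0 < t -> 0 < S -> sum_set A0 A1 g ->
  (forall u, 0 < u -> expR (- sig * ln u + ln (a u)) * K u g <=
     S * expR (- ln (L t) - eps * `|ln u - ln t|)) ->
  (forall u, t <= u -> expR (- sig * ln u + ln (a u)) * K u g <=
     S * expR (- ln (L u) - eps * (ln u - ln t))) ->
  (N g <= (C * S)%:E)%E.
Proof.
move=> e0; have [B B0 hB] := Lqnorm_decay q0 e0.
have [B' B'0 hB'] := Lqnorm_decay r0 e0.
have [C C0 hC] := weight_le_L r0 w0 sw Lam1.
pose M := B + B' * (B * expR C).
have M0 : 0 < M by rewrite addr_gt0 ?mulr_gt0 ?expR_gt0.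
exists (2 `^ recip r * M) => [|t g S t0 Sp gS h1 h2].
  by rewrite mulr_gt0 ?powR_gt0.
have S0 := ltW Sp.
pose J s := Lqnorm q `]s, +oo[ (fun u => (u `^ (- sig - recip q) * a u)%:E * Kfun A0 A1 u g)%E.
have Jle s c x : 0 < s -> 0 <= x -> (forall u, s < u ->
      expR (- sig * ln u + ln (a u)) * K u g <= x * expR (- eps * `|ln u - c|)) ->
    (J s <= (B * x)%:E)%E.
  move=> s0 x0 hx; apply: (hB _ _ x c x0).
  - by move=> u /=; rewrite !in_itv /= !andbT; exact: lt_trans.
  - move=> u /=; rewrite in_itv /= andbT => su; have u0 := lt_trans s0 su.
    by rewrite innerE// lee_fin !mulr_ge0 ?powR_ge0 ?expR_ge0 ?Kfin_ge0// ltW.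
  - move=> u /=; rewrite in_itv /= andbT => su; have u0 := lt_trans s0 su.
    rewrite innerE// lee_fin [leRHS]mulrAC [leRHS]mulrC ler_wpM2l ?powR_ge0//.
    exact: hx.
have ws s : 0 < s -> 0 <= s `^ (- recip r) * w s.
  by move=> s0; apply: mulr_ge0; [exact: powR_ge0|exact/ltW/w0].
have J0 s : (0 <= J s)%E by exact: Lqnorm_ge0.
have Lt : 0 < L t := L_gt0 r0 w0 sw Lam1 t0.
(* For the inner norms with [s] below [t], the first hypothesis gives a bump centred at [ln t]. *)
have J1 s : 0 < s -> (J s <= (B * (S / L t))%:E)%E.
  move=> s0; apply: (Jle s (ln t)) => // [|u su].
    by rewrite divr_ge0// ltW.
  apply: le_trans (h1 u (lt_trans s0 su)) _.
  by rewrite -mulrA ler_wpM2l// expRD expRN lnK ?posrE// mulNr.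
(* Beyond [t] the bump is centred at [ln s]. The factor 1/L(u) is replaced by the larger 1/L(s), as
   [L] is nondecreasing. *)
have J2 s : t <= s -> (J s <= (B * (S * expR (- ln (L s) - eps * (ln s - ln t))))%:E)%E.
  move=> ts; have s0 := lt_le_trans t0 ts.
  apply: (Jle s (ln s)) => // [|u su]; first by rewrite mulr_ge0 ?expR_ge0.
  have u0 := lt_trans s0 su.
  have := h2 u (le_trans ts (ltW su)).
  move/le_trans; apply; rewrite -mulrA ler_wpM2l// -expRD ler_expR.
  have : ln (L s) <= ln (L u).
    rewrite ler_ln ?posrE ?(L_gt0 r0 w0 sw Lam1)//.
    by apply: (le_L r0 w0 sw Lam1) => //; exact: ltW.
  rewrite ger0_norm; last by rewrite subr_ge0 ler_ln// ltW.
  by lra.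
rewrite /N (_ : `]0, +oo[%classic = `]0, t[ `|` `[t, +oo[); last first.
  by rewrite -itv_bndbnd_setU ?bnd_simp.
rewrite -mulrA; apply: LqnormU_le => //; first by rewrite mulr_ge0// ltW.
  (* On (0, t) the norm of the weight is L(t), which cancels the denominator in [J1]. *)
  have c0 : 0 < B * (S / L t) by rewrite mulr_gt0 ?divr_gt0.
  apply: (@le_trans _ _ ((B * (S / L t))%:E * Lam t)%E).
    rewrite -LqnormZ//; apply: le_Lqnorm => // s /=; rewrite in_itv /= => /andP[s0 st].
      by apply: mule_ge0; [rewrite lee_fin ws|exact: Lqnorm_ge0].
    by rewrite muleC; apply: lee_wpmul2r (J1 s s0); rewrite lee_fin ws.
  rewrite (_ : Lam t = (L t)%:E); last exact: (Lam_fin r0 w0 sw Lam1 t0).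
  rewrite -EFinM lee_fin -mulrA divfK ?gt_eqF//.
  by rewrite ler_wpM2r// /M lerDl !mulr_ge0 ?expR_ge0 ?(ltW B0) ?(ltW B'0).
(* On [t, +oo) the weight is at most e^C L(s). This cancels the factor 1/L(s) in [J2] and leaves the
   decay (s/t)^(-eps). *)
rewrite /M mulrDl; apply: le_trans (hB' _ _ (B * expR C * S) (ln t) _ _ _ _) _.
- by rewrite !mulr_ge0 ?expR_ge0 ?(ltW B0).
- by move=> s /=; rewrite !in_itv /= !andbT; exact: lt_le_trans.
- move=> s /=; rewrite in_itv /= andbT => ts; have s0 := lt_le_trans t0 ts.
  by apply: mule_ge0; [rewrite lee_fin ws|exact: Lqnorm_ge0].
- move=> s /=; rewrite in_itv /= andbT => ts; have s0 := lt_le_trans t0 ts.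
  apply: le_trans.
    by apply: lee_wpmul2l (J2 s ts); rewrite lee_fin ws.
  have := hC s s0 => hCs.
  rewrite -EFinM lee_fin -/(w s).
  set p := s `^ _; set x := expR (_ - _); set y := expR (- eps * _).
  rewrite [leLHS](_ : _ = (p * B * S) * (w s * x)); last by ring.
  rewrite [leRHS](_ : _ = (p * B * S) * (expR C * y)); last by ring.
  rewrite ler_wpM2l ?mulr_ge0 ?powR_ge0 ?(ltW B0)//.
  rewrite -[w s]lnK ?posrE ?w0// /x /y -!expRD ler_expR.
  rewrite ger0_norm; last by rewrite subr_ge0 ler_ln.
  by move: hCs; rewrite -/(Lam s) -/(L s); lra.
by rewrite lee_fin !mulrA lerDr mulr_ge0 ?(ltW B0).
Qed.

(* [S] stands for the supremum over [u >= t] of [(u/t)^eps K(u, f) / rho(u)]. *)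
Lemma Krho_le eps : 0 < eps -> eps <= sig / 2 -> eps <= (1 - sig) / 2 ->
  exists2 C : R, 0 < C & forall t f S, 0 < t -> sum_set A0 A1 f -> 0 < S ->
  (forall u, t <= u -> K u f <= S * expR (log_rho u - eps * (ln u - ln t))) ->
  sum_set A0 X f /\
  Kfin A0 X (expR (log_rho t)) f <= C * S * expR (log_rho t).
Proof.
move=> e0 e1 e2.
have [C C0 hC] := Rspace_N_le e0.
have [Q Q1 hQ] := KfinD hA0 hA1.
have Q0 : 0 < Q by exact: lt_le_trans Q1.
have [D D0 hD] := log_rho_slow (divr_gt0 sig0 (ltr0Sn _ 1)).
have s10 : 0 < (1 - sig) / 2 by rewrite divr_gt0 ?subr_gt0.
have [E E0 hE] := sa s10.
pose M := 2 * expR E + Q * (1 + 2 * expR D).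
have [eE eD] : 0 < expR E /\ 0 < expR D by rewrite !expR_gt0.
have M0 : 0 < M by rewrite addr_gt0 ?mulr_gt0 ?addr_gt0 ?mulr_gt0.
exists (2 + C * M) => [|t f S t0 fS S0 hS].
  by rewrite addr_gt0 ?mulr_gt0.
have rho0 : 0 < expR (log_rho t) := expR_gt0 _.
(* The hypothesis at u = t gives K(t, f) <= S rho(t). As [S] is positive, twice this bound is
   strictly larger than K(t, f) and some decomposition stays below it. *)
have [f0 [f1 [f0A f1A fE fm]]] :
    exists f0 f1, [/\ carrier A0 f0, carrier A1 f1, f = f0 + f1 &
      qnorm A0 f0 + t * qnorm A1 f1 < 2 * S * expR (log_rho t)].
  apply: (Kfin_approx p0 p1 (ltW t0) fS).
  have := hS t (lexx _); rewrite subrr mulr0 subr0 => /le_lt_trans; apply.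
  by rewrite ltr_pM2r// ltr_pMl// ltr1n.
have [n0 n1] := (p0 f0A, p1 f1A).
have tn1 : 0 <= t * qnorm A1 f1 by rewrite mulr_ge0// ltW.
have f1S : sum_set A0 A1 f1 := sum_set_snd hA0 f1A.
have k1 u : 0 < u -> K u f1 <= 2 * S * expR (log_rho t + (ln u - ln t)).
  move=> u0; apply: le_trans (Kfin_snd hA0 hA1 (ltW u0) f1A) _.
  rewrite expRD [X in _ <= _ * (_ * X)]expRD expRN !lnK ?posrE//.
  rewrite [leRHS](_ : _ = 2 * S * expR (log_rho t) * (u / t)); last by ring.
  rewrite [leLHS](_ : _ = (t * qnorm A1 f1) * (u / t)); last by field; rewrite gt_eqF.
  by rewrite ler_wpM2r ?divr_ge0 ?ltW//; lra.
have k2 u : t <= u -> K u f1 <=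
    Q * (1 + 2 * expR D) * S * expR (log_rho u - eps * (ln u - ln t)).
  move=> tu; have u0 : 0 < u by exact: lt_le_trans tu.
  have -> : f1 = f + - f0 by rewrite fE addrAC subrr add0r.
  apply: le_trans (hQ u f (- f0) (ltW u0) fS (sum_set_fst hA1 (carrierN hA0 f0A))) _.
  rewrite -!mulrA ler_wpM2l ?(ltW Q0)// mulrDl mul1r lerD ?hS//.
  apply: le_trans (Kfin_fst hA0 hA1 (ltW u0) (carrierN hA0 f0A)) _.
  rewrite (qnormN hA0 f0A); apply: (@le_trans _ _ (2 * S * expR (log_rho t))); first by lra.
  (* Up to the constant [D], [log_rho] grows at rate at least [sig / 2], which is at least [eps].
     Hence rho(t) <= e^D rho(u) (u/t)^(-eps). *)
  rewrite -!mulrA ler_pM2l// mulrCA ler_pM2l// -expRD ler_expR.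
  have := hD u t u0 t0; rewrite ler_norml => /andP[+ _].
  have lut : 0 <= ln u - ln t by rewrite subr_ge0 ler_ln.
  rewrite ger0_norm//.
  by nra.
have lnL u : 0 < u -> - sig * ln u + ln (a u) + log_rho u = - ln (L u).
  by move=> u0; rewrite /log_rho; ring.
have MQ : Q * (1 + 2 * expR D) <= M by rewrite lerDr mulr_ge0 ?(ltW eE).
have ME : 2 * expR E <= M by rewrite lerDl ?mulr_ge0 ?addr_ge0 ?mulr_ge0 ?(ltW eD) ?(ltW Q0).
have k3 u : t <= u -> expR (- sig * ln u + ln (a u)) * K u f1 <=
    M * S * expR (- ln (L u) - eps * (ln u - ln t)).
  move=> tu; have u0 : 0 < u by exact: lt_le_trans tu.
  apply: le_trans; first by apply: ler_wpM2l (k2 u tu); exact: expR_ge0.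
  rewrite mulrCA -expRD addrA lnL//.
  by rewrite ler_wpM2r ?expR_ge0// ler_wpM2r ?(ltW S0).
have Nf1 : (N f1 <= (C * (M * S))%:E)%E.
  apply: (hC t) => // [|u u0]; first by rewrite mulr_gt0.
  have [tu|/ltW ut] := leP t u.
    apply: le_trans (k3 u tu) _; rewrite ler_wpM2l ?mulr_ge0 ?(ltW M0) ?(ltW S0)//.
    rewrite ger0_norm; last by rewrite subr_ge0 ler_ln.
    rewrite ler_expR lerB// lerN2 ler_ln ?posrE ?(L_gt0 r0 w0 sw Lam1)//.
    exact: (le_L r0 w0 sw Lam1).
  apply: le_trans; first by apply: ler_wpM2l (k1 u u0); exact: expR_ge0.
  apply: (@le_trans _ _ (2 * expR E * S * expR (- ln (L t) - eps * `|ln u - ln t|))); last first.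
    by rewrite ler_wpM2r ?expR_ge0// ler_wpM2r ?(ltW S0).
  rewrite (mulrAC 2 (expR E)) -[leRHS]mulrA mulrCA -!expRD.
  rewrite ler_wpM2l ?mulr_ge0 ?(ltW S0)// ler_expR.
  (* For u <= t the factor (u/t)^(1 - sig) is available: half of its exponent pays for the variation
     of [a], the other half for the decay of order [eps]. *)
  have := hE u t u0 t0.
  have lut : ln u - ln t <= 0 by rewrite subr_le0 ler_ln.
  rewrite ler0_norm// /log_rho.
  by nra.
have f1X : carrier X f1 by split => //; apply: le_lt_trans Nf1 (ltry _).
split; first by rewrite fE; exists f0 => //; exists f1.
rewrite fE; apply: le_trans (Kfin_le p0 X_norm_ge0 (expR_ge0 _) f0A f1X) _.
have : qnorm X f1 <= C * (M * S) by rewrite -lee_fin -NE.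
move: fm; set rho := expR _ => fm h.
have : rho * qnorm X f1 <= rho * (C * (M * S)) by rewrite ler_wpM2l ?(ltW rho0).
by nra.
Qed.

End Holmstedt.

(** * Transfer between weighted norms *)

Section transfer.
Context (R : realType).
Implicit Types (q : \bar R) (phi psi : R -> R) (P : R).

(** Bounds the variation over an interval [e^k, e^(k+1)) by a fixed factor, as needed to replace
    [phi] by its samples at e^k. *)
Definition log_lipschitz P phi := forall s t, 0 < s -> 0 < t ->
  phi s <= expR (P * (1 + `|ln s - ln t|)) * phi t.

Lemma eq_Lqnorm q D (f g : R -> \bar R) : (forall x, D x -> f x = g x) ->
  Lqnorm q D f = Lqnorm q D g.
Proof.
move=> fg; rewrite /Lqnorm; congr Lnorm; apply/funext => x.
by rewrite /patch; case: ifPn => //; rewrite inE; exact: fg.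
Qed.

Lemma ln_floor_dist (u : R) : `|ln u - (Num.floor (ln u))%:~R| <= 1.
Proof. by have /andP[h1 h2] := ln_floor u; rewrite ger0_norm; lra. Qed.

Lemma lq_ge q (x : int -> R) k : (0 < q)%E -> (forall i, 0 <= x i) ->
  ((x k)%:E <= lq q x)%E.
Proof.
move=> q0 x0; case: q q0 => [r| |]//; last first.
  by move=> _; apply: ereal_sup_ubound; exists k.
rewrite lte_fin => r0; rewrite /lq.
have h : ((x k `^ r)%:E <= \esum_(i in [set: int]) (x i `^ r)%:E)%E.
  by apply: (@esum_ge _ _ _ (fun k => (x k `^ r)%:E)); exists [set k] => //; rewrite fsbig_set1.
have -> : (x k)%:E = ((x k `^ r)%:E `^ r^-1)%E.
  by rewrite poweR_EFin -powRrM mulfV ?gt_eqF// powRr1.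
apply: gt0_ler_poweR => //; first by rewrite invr_ge0 ltW.
  by rewrite in_itv /= leey andbT lee_fin powR_ge0.
by rewrite in_itv /= leey andbT (le_trans _ h)// lee_fin powR_ge0.
Qed.

Lemma lq_sample_le q P phi : (0 < q)%E -> 0 <= P ->
  (forall t, 0 < t -> 0 <= phi t) -> log_lipschitz P phi ->
  (lq q (fun k => phi (expR k%:~R)) <= (expR (recip q + 2 * P))%:E *
     Lqnorm q `]0%R, +oo[ (fun u => (u `^ (- recip q) * phi u)%:E))%E.
Proof.
move=> q0 P0 phi0 hphi.
rewrite expRD EFinM -muleA -LqnormZ ?expR_gt0//.
apply: lq_le_Lqnorm => // [k|u u0]; first by rewrite phi0 ?expR_gt0.
rewrite -EFinM lee_fin mulrCA ler_wpM2l ?powR_ge0//.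
apply: le_trans (hphi _ u (expR_gt0 _) u0) _.
rewrite ler_wpM2r ?phi0// ler_expR expRK distrC.
by have := ln_floor_dist u; nra.
Qed.

(** Both functions are sampled at the points e^k and the Schur test compares the samples. Each
    passage between a function and its samples costs e^(2P), as logarithmic distances are at most
    1. *)
Lemma Lqnorm_transfer q P C1 B (w : int -> int -> R) phi psi :
  (0 < q)%E -> 0 <= P -> 0 < C1 -> 0 < B ->
  (forall j k, 0 <= w j k <= 1) ->
  (forall r, q = r%:E -> forall k,
     (\esum_(j in [set: int]) (w j k `^ r)%:E <= B%:E)%E) ->
  (forall t, 0 < t -> 0 <= phi t) -> (forall t, 0 < t -> 0 <= psi t) ->
  log_lipschitz P phi -> log_lipschitz P psi ->
  (forall j S, 0 <= S -> (forall k, w j k * phi (expR k%:~R) <= S) ->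
     psi (expR j%:~R) <= C1 * S) ->
  (Lqnorm q `]0%R, +oo[ (fun u => (u `^ (- recip q) * psi u)%:E) <=
   (expR (recip q) * (expR (2 * P) * C1 * B `^ recip q) *
      expR (recip q + 2 * P))%:E *
   Lqnorm q `]0%R, +oo[ (fun u => (u `^ (- recip q) * phi u)%:E))%E.
Proof.
move=> q0 P0 C10 B0 w01 wB phi0 psi0 hphi hpsi h.
rewrite EFinM -muleA.
pose x k : R := expR (2 * P) * psi (expR k%:~R).
have x0 k : 0 <= x k by rewrite mulr_ge0 ?expR_ge0 ?psi0 ?expR_gt0.
apply: (@le_trans _ _ ((expR (recip q))%:E * lq q x)%E).
  apply: Lqnorm_le_lq => // u /=; rewrite in_itv /= andbT => u0.
    by rewrite lee_fin mulr_ge0 ?powR_ge0 ?psi0.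
  rewrite lee_fin ler_wpM2l ?powR_ge0//.
  apply: le_trans (hpsi u _ u0 (expR_gt0 (Num.floor (ln u))%:~R)) _.
  rewrite ler_wpM2r ?psi0 ?expR_gt0// ler_expR expRK.
  by have := ln_floor_dist u; nra.
rewrite (EFinM (expR (recip q))) -muleA; apply: lee_wpmul2l; first by rewrite lee_fin expR_ge0.
have := @lq_schur R q w (fun k => phi (expR k%:~R)) x B (expR (2 * P) * C1) q0 B0.
rewrite mulr_gt0 ?expR_gt0// => /(_ isT _ x0 w01 wB _)/le_trans; apply.
- by move=> k; rewrite phi0 ?expR_gt0.
- move=> j S S0 hS; rewrite /x -mulrA ler_wpM2l ?expR_ge0//.
  exact: h.
apply: lee_wpmul2l; last exact: lq_sample_le.
by rewrite lee_fin !mulr_ge0 ?expR_ge0 ?powR_ge0 ?(ltW C10).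
Qed.

(** The r-th power of an exponential kernel is again one, with rate [del * r], so column sums are
    bounded for every finite exponent. *)
Lemma kernel_bound q (al c del : R) : (0 < q)%E -> 0 < al -> 0 < del -> 0 <= c ->
  exists2 B : R, 0 < B & forall tau : int -> R,
    (forall i j, i <= j -> al * (j - i)%:~R - c <= tau j - tau i) ->
    forall r, q = r%:E -> forall s,
    (\esum_(k in [set: int]) (expR (- del * `|s - tau k|) `^ r)%:E <= B%:E)%E.
Proof.
move=> q0 al0 del0 c0; case: q q0 => [r| |]//; last by move=> _; exists 1.
rewrite lte_fin => r0.
have [B B0 hB] := kernel_sum al0 (mulr_gt0 del0 r0) c0.
exists B => // tau htau _ [<-] s.
rewrite (eq_esum (b := fun k => (expR (- (del * r) * `|s - tau k|))%:E)); first exact: hB.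
by move=> k _; congr EFin; rewrite powRE ?expR_gt0// expRK; congr expR; ring.
Qed.

End transfer.

(** * Reiteration *)

Section exponents.
Context (R : realType).
Implicit Types (C D H P x y th sig : R).

Lemma scaled_le_norm c x : 0 <= c <= 1 -> c * x <= `|x|.
Proof.
move=> /andP[c0 c1]; apply: le_trans (ler_norm _) _.
by rewrite normrM ger0_norm// ler_piMl.
Qed.

Lemma add1_norm_le2 x : 0 <= x -> x <= 1 -> 1 + `|x| <= 2.
Proof. by move=> x0 x1; rewrite ger0_norm//; lra. Qed.

Lemma add1_dist_le C x l l' : l <= x -> x <= l' -> l' - l <= C + 2 ->
  1 + `|x - l| <= C + 3.
Proof. by move=> lx xl' ll'; rewrite ger0_norm ?subr_ge0//; lra. Qed.

Lemma crossing_dist_le C x y l l' m : 0 <= C -> l <= x -> x <= l' ->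
  l' - l <= C + 2 -> 0 <= y -> y - C <= m - l ->
  `|m - x| <= C + 2 + 2 * C + (m - l).
Proof. by move=> *; rewrite ler_norml; apply/andP; split; lra. Qed.

(** The exponents in [F_lipschitz]: [x] is the logarithmic distance, [l] and [l'] are values of
    [log_rho], and [m] and [m'] values of ln a(rho). Since |l - l'| <= C + 2 |x|, every term is at
    most linear in |x|. *)
Lemma exponent_diff_le C D th sig x l l' m m' : 0 <= C -> 0 <= D ->
  0 <= th <= 1 -> 0 <= sig <= 1 ->
  `|l - l' - sig * x| <= C + 1 * `|x| -> m - m' <= D + 1 * `|l - l'| ->
  - th * l + m + `|x| <= (2 * C + D + 5) * (1 + `|x|) + (- th * l' + m').
Proof.
move=> C0 D0 th01 sig01.
have h1 : - th * (l - l') <= `|l - l'|.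
  by rewrite mulNr -mulrN -[leRHS]normrN scaled_le_norm.
have h2 := scaled_le_norm x sig01.
have h3 : - `|x| <= sig * x.
  by rewrite lerNl -mulrN -[leRHS]normrN scaled_le_norm.
have h4 : 0 <= (2 * C + D) * `|x| by rewrite mulr_ge0 ?addr_ge0 ?mulr_ge0.
have := normr_ge0 x; move: h1 h2 h3 h4; move: (`|x|) => X h1 h2 h3 h4 X0.
rewrite ler_norml => /andP[h5 h6].
have h7 : `|l - l'| <= C + 2 * X by rewrite ler_norml; apply/andP; split; lra.
by lra.
Qed.

(** The exponents in [Krho_of_samples]: [l], [lk], [lu] are the values of [log_rho] at e^i, e^k and
    u. The surplus (1 - th)(lu - l) equals 4 del (lu - l). Three of these four parts pay for the
    variation of [a], for the allowed growth of the samples and for eps x; the fourth is bounded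
    below by a constant. *)
Lemma sample_exponent_le C H P eps del th sig x y al au l lk lu :
  0 <= th -> 0 <= sig -> 0 <= C -> 0 <= del -> 0 <= x -> 0 <= y ->
  1 - th = 4 * del -> eps <= sig / 2 * del ->
  sig / 2 * x - C <= lu - l -> sig / 2 * y - C <= lu - lk ->
  al - au <= H + del * `|l - lu| ->
  th * lu - au + P * 2 + del * (lk - l) <=
  P * 2 + H + 4 * C + 1 + ((th - 1) * l - al) + (lu - eps * x).
Proof.
move=> th0 sig0 C0 del0 x0 y0 thE epsE h1 h2 h3.
have sx : 0 <= sig / 2 * x by rewrite !mulr_ge0 ?invr_ge0.
have sy : 0 <= sig / 2 * y by rewrite !mulr_ge0 ?invr_ge0.
have h4 : `|l - lu| <= lu - l + 2 * C.
  by rewrite ler_norml; apply/andP; split; lra.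
have h5 : del * `|l - lu| <= del * (lu - l + 2 * C) by rewrite ler_wpM2l.
have h6 : del * (lk - l) <= del * (lu - l + C) by rewrite ler_wpM2l//; lra.
have h7 : eps * x <= del * (lu - l + C).
  apply: (@le_trans _ _ (sig / 2 * del * x)); first by rewrite ler_wpM2r.
  by rewrite mulrAC mulrC ler_wpM2l//; lra.
have h8 : del * C <= C / 4.
  by rewrite mulrC ler_wpM2l//; lra.
have h10 : 0 <= del * (lu - l + C) by rewrite mulr_ge0//; lra.
have h9 : (1 - th) * (lu - l) = 4 * del * (lu - l) by rewrite thE.
by lra.
Qed.

Lemma eps_le th sig : 0 < sig -> sig < 1 -> 0 <= th -> th < 1 ->
  let eps := sig * (1 - sig) * (1 - th) / 8 in
  [/\ 0 < eps, eps <= sig / 2, eps <= (1 - sig) / 2 & eps <= sig / 2 * ((1 - th) / 4)].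
Proof.
move=> sig0 sig1 th0 th1 eps.
have s1 : 0 < 1 - sig by rewrite subr_gt0.
have t1 : 0 < 1 - th by rewrite subr_gt0.
have u1 : 0 < sig * (1 - sig) by rewrite mulr_gt0.
have v1 : 0 < sig * (1 - th) by rewrite mulr_gt0.
have st : 0 <= sig * (1 - sig) * th by rewrite mulr_ge0// ltW.
have ss : 0 <= sig * sig * (1 - th) by rewrite !mulr_ge0// ltW.
have ss2 : 0 <= sig * sig by rewrite mulr_ge0// ltW.
have s2 : 0 <= (1 - sig) * (1 - sig) by rewrite mulr_ge0// ltW.
split; rewrite /eps; first by rewrite divr_gt0 ?mulr_gt0.
- by lra.
- by lra.
- by lra.
Qed.

End exponents.

(** * The two inclusions of the reiteration formula *)

Section reiteration.
Context (R : realType) (V : lmodType R) (A0 A1 : qspace V).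
Hypotheses (hA0 : quasi_banach A0) (hA1 : quasi_banach A1).
Variables (sig : R) (q1 r1 : \bar R) (a1 b1 : R -> R).
Hypotheses (sig0 : 0 < sig) (sig1 : sig < 1) (hq1 : (0 < q1)%E) (hr1 : (0 < r1)%E).
Hypotheses (a10 : positive_on_half_line a1) (b10 : positive_on_half_line b1).
Hypotheses (sa1 : log_slow a1) (sb1 : log_slow b1).
Let Lam t := Lqnorm r1 `]0, t[ (fun s => (s `^ (- recip r1) * (b1 s / a1 s))%:E).
Hypothesis Lam1 : (Lam 1 < +oo)%E.
Variables (theta : R) (q : \bar R) (a : R -> R).
Hypotheses (th0 : 0 <= theta) (th1 : theta < 1) (hq : (0 < q)%E).
Hypotheses (a0 : positive_on_half_line a) (sa : log_slow a).

Let X := Rspace A0 A1 sig r1 b1 q1 a1.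
Let lrho := log_rho sig r1 a1 b1.
Let c1 t := a1 t * fine (Lam t).
Let rho t := t `^ sig * (1 / c1 t).
Let asharp t := c1 t `^ theta * a (rho t).
(* Up to the factor [u^(-1/q)], the integrands of the norms of
   [Kspace A0 A1 (theta * sig) q asharp] and [Kspace A0 X theta q a]. *)
Let F f t := expR (- theta * lrho t + ln (a (rho t))) * Kfin A0 A1 t f.
Let G f t := expR (- theta * ln t + ln (a t)) * Kfin A0 X t f.
Let p0 := qnorm_ge0 hA0.
Let p1 := qnorm_ge0 hA1.
Let pX : nonneg_norm X := @X_norm_ge0 R V A0 A1 sig q1 r1 a1 b1.

Let w0 : positive_on_half_line (fun t => b1 t / a1 t).
Proof. by move=> t t0; rewrite divr_gt0 ?a10 ?b10. Qed.

Let sw : log_slow (fun t => b1 t / a1 t).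
Proof.
apply: log_slowM => //; last exact: log_slowV.
by move=> t t0; rewrite invr_gt0 a10.
Qed.

Let L_gt0 t : 0 < t -> 0 < fine (Lam t).
Proof. exact: (L_gt0 hr1 w0 sw Lam1). Qed.

Let c1_gt0 t : 0 < t -> 0 < c1 t.
Proof. by move=> t0; rewrite mulr_gt0 ?a10 ?L_gt0. Qed.

Lemma rhoE t : 0 < t -> rho t = expR (lrho t).
Proof.
move=> t0; have Lt := L_gt0 t0; have at0 := a10 t0.
rewrite /rho /lrho /log_rho -/(Lam t) -addrA expRD -opprD expRN -lnM ?posrE//.
by rewrite lnK ?posrE ?mulr_gt0// powRE// div1r.
Qed.

(** The identity u^(-theta sig) c1(u)^theta = rho(u)^(-theta) shows that the weight on the right of
    the theorem is t^(-theta) a(t) evaluated at t = rho(u). *)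
Lemma Kspace_sharpE f u : 0 < u -> sum_set A0 A1 f ->
  ((u `^ (- (theta * sig) - recip q) * asharp u)%:E * Kfun A0 A1 u f)%E =
  (u `^ (- recip q) * F f u)%:E.
Proof.
move=> u0 hf; rewrite KfinE ?(ltW u0)// -EFinM; congr EFin.
rewrite powRD; last by apply/implyP => _; rewrite gt_eqF.
rewrite /F expRD lnK ?posrE ?a0 ?rhoE ?expR_gt0//.
have -> : expR (- theta * lrho u) = u `^ (- (theta * sig)) * c1 u `^ theta.
  rewrite !powRE ?c1_gt0// -expRD; congr expR.
  by rewrite /c1 lnM ?posrE ?a10 ?L_gt0// /lrho /log_rho -/(Lam u); ring.
by rewrite /asharp rhoE//; ring.
Qed.

Lemma Kspace_RE f u : 0 < u -> sum_set A0 X f ->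
  ((u `^ (- theta - recip q) * a u)%:E * Kfun A0 X u f)%E =
  (u `^ (- recip q) * G f u)%:E.
Proof.
move=> u0 hf; rewrite KfinE ?(ltW u0)// -EFinM; congr EFin.
rewrite powRD; last by apply/implyP => _; rewrite gt_eqF.
by rewrite /G expRD lnK ?posrE ?a0// (powRE (- theta))//; ring.
Qed.

Let NF f := Lqnorm q `]0%R, +oo[ (fun u => (u `^ (- recip q) * F f u)%:E).
Let NG f := Lqnorm q `]0%R, +oo[ (fun u => (u `^ (- recip q) * G f u)%:E).

Let F_ge0 f t : 0 < t -> 0 <= F f t.
Proof. by move=> t0; rewrite mulr_ge0 ?expR_ge0// Kfin_ge0// ltW. Qed.

Let G_ge0 f t : 0 < t -> 0 <= G f t.
Proof. by move=> t0; rewrite mulr_ge0 ?expR_ge0// Kfin_ge0// ltW. Qed.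

Let rho_slow eps := @log_rho_slow R sig r1 a1 b1 hr1 a10 b10 sa1 sb1 Lam1 eps.

Lemma F_lipschitz : exists2 P : R, 0 <= P & forall f, sum_set A0 A1 f -> log_lipschitz P (F f).
Proof.
have [C C0 hC] := rho_slow ltr01; have [D D0 hD] := sa ltr01.
exists (2 * C + D + 5) => [|f fS s t s0 t0]; first by lra.
have hK := Kfin_comparable p0 p1 s0 t0 fS.
rewrite /F; apply: le_trans; first by apply: ler_wpM2l hK; exact: expR_ge0.
rewrite !mulrA -!expRD ler_wpM2r ?Kfin_ge0 ?(ltW t0)// ler_expR.
have := hD (rho s) (rho t); rewrite !rhoE ?expR_gt0// !expRK => /(_ isT isT).
apply: exponent_diff_le (hC s t s0 t0) => //; apply/andP; split => //; exact: ltW.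
Qed.

Lemma G_lipschitz : exists2 P : R, 0 <= P & forall f, sum_set A0 X f -> log_lipschitz P (G f).
Proof.
have [D D0 hD] := sa ltr01.
exists (D + 3) => [|f fS s t s0 t0]; first by lra.
have hK := Kfin_comparable p0 pX s0 t0 fS.
rewrite /G; apply: le_trans; first by apply: ler_wpM2l hK; exact: expR_ge0.
rewrite !mulrA -!expRD ler_wpM2r ?Kfin_ge0 ?(ltW t0)// ler_expR.
have := hD s t s0 t0; set e := ln s - ln t => ha.
have : - theta * e <= `|e|.
  by rewrite mulNr -mulrN -[`|e|]normrN scaled_le_norm// th0 ltW.
have : 0 <= D * `|e| by rewrite mulr_ge0.
by have := normr_ge0 e; rewrite /e; lra.
Qed.

Lemma rho_growth : exists2 C : R, 0 <= C & forall s t, 0 < s -> s <= t ->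
  sig / 2 * (ln t - ln s) - C <= lrho t - lrho s /\ lrho t - lrho s <= C + 2 * (ln t - ln s).
Proof.
have [C C0 hC] := rho_slow (divr_gt0 sig0 (ltr0Sn _ 1)).
exists C => // s t s0 st; have t0 := lt_le_trans s0 st.
have lst : 0 <= ln t - ln s by rewrite subr_ge0 ler_ln.
have := hC t s t0 s0; rewrite (ger0_norm lst) ler_norml => /andP[h1 h2].
rewrite -/lrho in h1 h2.
have h3 : 0 <= (1 - sig) * (ln t - ln s) by rewrite mulr_ge0// subr_ge0 ltW.
by split; lra.
Qed.

Let E (k : int) : R := expR k%:~R.

Lemma rho_int_growth : exists2 C : R, 0 <= C &
  (forall i j : int, i <= j -> sig / 2 * (j - i)%:~R - C <= lrho (E j) - lrho (E i)) /\
  (forall i, lrho (E (i + 1)) - lrho (E i) <= C + 2).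
Proof.
have [C C0 hC] := rho_growth; exists C => //; split=> [i j ij|i].
  have := hC (E i) (E j) (expR_gt0 _) _.
  by rewrite ler_expR ler_int => /(_ ij)[+ _]; rewrite !expRK intrB.
have := hC (E i) (E (i + 1)) (expR_gt0 _) _.
rewrite ler_expR ler_int lerDl => /(_ isT)[_].
by rewrite !expRK intrD [X in 2 * X](_ : _ = 1) ?mulr1//; ring.
Qed.

(** By [K_le_Krho], F(e^j) is at most a multiple of G(rho(e^j)), hence of G(e^k) for the integer
    part k of ln rho(e^j). The column sums of the kernel are bounded because ln rho(e^j) grows
    linearly in j. *)
Lemma sharp_norm_le_reiterated : exists2 C : R, 0 < C & forall f, sum_set A0 X f ->
  (NF f <= C%:E * NG f)%E.
Proof.
have [P P0 hP] := F_lipschitz; have [P' P'0 hP'] := G_lipschitz.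
have [C C0 [hC _]] := rho_int_growth.
have sig20 : 0 < sig / 2 by rewrite divr_gt0.
have [B B0 hB] := kernel_bound hq sig20 ltr01 C0.
have [D D0 hD] := K_le_Krho hA0 hA1 sig1 hq1 hr1 a10 b10 sa1 sb1 Lam1.
pose Pm := P + P'.
have Pm0 : 0 <= Pm by rewrite addr_ge0.
pose C1 := D * expR (Pm * 2) * expR 1.
have C10 : 0 < C1 by rewrite !mulr_gt0 ?expR_gt0.
exists (expR (recip q) * (expR (2 * Pm) * C1 * B `^ recip q) * expR (recip q + 2 * Pm)).
  by rewrite !mulr_gt0 ?expR_gt0 ?powR_gt0.
move=> f fS.
have fA : sum_set A0 A1 f.
  by case: fS => f0 f0A [g [gA _] <-]; apply: sum_setD => //; exact: sum_set_fst.
have lip (phi : R -> R) p : (forall t, 0 < t -> 0 <= phi t) -> p <= Pm ->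
    log_lipschitz p phi -> log_lipschitz Pm phi.
  move=> phi0 pP h s t s0 t0; apply: le_trans (h s t s0 t0) _.
  by rewrite ler_wpM2r ?phi0// ler_expR ler_wpM2r// addr_ge0.
apply: (@Lqnorm_transfer R q Pm C1 B
  (fun j k => expR (- 1 * `|k%:~R - lrho (E j)|))) => //.
- by move=> j k; rewrite expR_ge0 expR_le1 mulNr mul1r oppr_le0 normr_ge0.
- by move=> r qr k; exact: hB qr _.
- exact: G_ge0.
- exact: F_ge0.
- by apply: lip (hP' f fS) => //; [exact: G_ge0|rewrite /Pm; lra].
- by apply: lip (hP f fA) => //; [exact: F_ge0|rewrite /Pm; lra].
move=> j S S0 hS.
set rj := rho (E j); have rjE : rj = expR (lrho (E j)) by rewrite /rj rhoE ?expR_gt0.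
(* At this single index the kernel is at least 1/e, so the bound [S] already controls G(e^k). *)
pose k := Num.floor (lrho (E j)).
have kd : `|lrho (E j) - k%:~R| <= 1.
  by have := ln_floor_dist (expR (lrho (E j))); rewrite !expRK.
have FG : F f (E j) <= D * G f rj.
  have := hD (E j) f (expR_gt0 _) fS; rewrite /F /G -rjE -/X -/lrho.
  rewrite [X in expR (- theta * X + _)](_ : lrho (E j) = ln rj); last by rewrite rjE expRK.
  by move=> h; rewrite mulrCA ler_wpM2l ?expR_ge0.
have GG : G f rj <= expR (Pm * 2) * G f (E k).
  have := hP' f fS rj (E k); rewrite rjE !expR_gt0 !expRK => /(_ isT isT).
  move/le_trans; apply; rewrite ler_wpM2r ?G_ge0 ?expR_gt0// ler_expR.
  by have := normr_ge0 (lrho (E j) - k%:~R); rewrite /Pm; nra.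
have := hS k; rewrite mulNr mul1r expRN ler_pdivrMl ?expR_gt0// => hk.
have GS : G f (E k) <= expR 1 * S.
  apply: le_trans hk _; rewrite ler_wpM2r// ler_expR distrC.
  exact: kd.
apply: le_trans FG _; rewrite /C1 -!mulrA ler_wpM2l ?(ltW D0)//.
apply: le_trans GG _; rewrite ler_wpM2l ?expR_ge0//.
Qed.

Let eps := sig * (1 - sig) * (1 - theta) / 8.
Let del := (1 - theta) / 4.

Let del0 : 0 < del. Proof. by rewrite divr_gt0 ?subr_gt0. Qed.

Let eps_bounds : [/\ 0 < eps, eps <= sig / 2, eps <= (1 - sig) / 2 &
  eps <= sig / 2 * del].
Proof.
exact: eps_le.
Qed.

(** Reduces the hypothesis of [Krho_le] at e^i to the points e^k with k >= i. Because theta < 1, the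
    samples of [F] may grow like the power [del] of rho(e^k)/rho(e^i); this room becomes the decay
    of the Schur kernel. *)
Lemma Krho_of_samples : exists2 C : R, 0 < C & forall f i S, sum_set A0 A1 f ->
  0 < S -> (forall k : int, i <= k ->
     F f (E k) <= S * expR (del * (lrho (E k) - lrho (E i)))) ->
  sum_set A0 X f /\ G f (rho (E i)) <= C * S.
Proof.
have [e0 e1 e2 e3] := eps_bounds.
have [D D0 hD] := Krho_le hA0 hA1 sig0 sig1 hq1 hr1 a10 b10 sa1 sb1 Lam1 e0 e1 e2.
have [P P0 hP] := F_lipschitz.
have [C C0 hC] := rho_growth.
have [H H0 hH] := sa del0.
pose T := P * 2 + H + 4 * C + 1.
exists (D * expR T) => [|f i S fS S0 hS]; first by rewrite mulr_gt0 ?expR_gt0.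
set t := E i; have t0 : 0 < t := expR_gt0 _.
set al := ln (a (rho t)).
have Ke u : 0 < u -> Kfin A0 A1 u f = expR (theta * lrho u - ln (a (rho u))) * F f u.
  by move=> u0; rewrite /F mulrA -expRD [X in expR X](_ : _ = 0) ?expR0 ?mul1r//; ring.
(* Multiplied by rho(t) and by the weight rho(t)^(-theta) a(rho(t)) of [G], this leaves exactly e^T
   S. *)
pose S' := expR T * S * expR ((theta - 1) * lrho t - al).
have S'0 : 0 < S' by rewrite !mulr_gt0 ?expR_gt0.
have hK u : t <= u -> Kfin A0 A1 u f <= S' * expR (lrho u - eps * (ln u - ln t)).
  move=> tu; have u0 : 0 < u by exact: lt_le_trans tu.
  pose k := Num.floor (ln u).
  have ik : i <= k by rewrite /k floor_ge_int -[X in X <= _]expRK ler_ln.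
  have [hg1 hg2] := hC t u t0 tu.
  have ku : E k <= u.
    by rewrite -[leRHS]lnK ?posrE// ler_expR; have /andP[] := ln_floor u.
  have [hk1 hk2] := hC (E k) u (expR_gt0 _) ku.
  have lku : 0 <= ln u - ln (E k) by rewrite subr_ge0 ler_ln ?posrE ?expR_gt0.
  have lku1 : ln u - ln (E k) <= 1.
    by rewrite expRK lerBlDl; have /andP[_ /ltW] := ln_floor u.
  have ltu : 0 <= ln u - ln t by rewrite subr_ge0 ler_ln.
  rewrite Ke//.
  have FF : F f u <= expR (P * 2) * F f (E k).
    apply: le_trans (hP f fS u (E k) u0 (expR_gt0 _)) _.
    rewrite ler_wpM2r ?F_ge0 ?expR_gt0// ler_expR ler_wpM2l//.
    exact: add1_norm_le2.
  apply: le_trans; first by apply: ler_wpM2l FF; exact: expR_ge0.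
  apply: le_trans.
    by apply: ler_wpM2l; [exact: expR_ge0|apply: ler_wpM2l (hS k ik); exact: expR_ge0].
  rewrite /S' [leLHS](_ : _ = S * (expR (theta * lrho u - ln (a (rho u))) *
    expR (P * 2) * expR (del * (lrho (E k) - lrho t)))); last by rewrite /t; ring.
  rewrite [leRHS](_ : _ = S * (expR T * expR ((theta - 1) * lrho t - al) *
    expR (lrho u - eps * (ln u - ln t)))); last by ring.
  rewrite ler_pM2l// -!expRD ler_expR.
  have rt0 : 0 < rho t by rewrite rhoE ?expR_gt0.
  have ru0 : 0 < rho u by rewrite rhoE ?expR_gt0.
  have ha : al - ln (a (rho u)) <= H + del * `|lrho t - lrho u|.
    by have := hH _ _ rt0 ru0; rewrite -/al [in ln (rho t)]rhoE// [in ln (rho u)]rhoE// !expRK.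
  have thE : 1 - theta = 4 * del by rewrite /del mulrC divfK.
  exact: (sample_exponent_le P th0 (ltW sig0) C0 (ltW del0) ltu lku thE e3 hg1 hk1 ha).
have [fX hKr] := hD t f S' t0 fS S'0 hK.
split=> //; rewrite /G rhoE// expRK -rhoE// -/al.
move: hKr; rewrite -rhoE//; set k' := Kfin _ _ _ _ => hKr.
apply: le_trans; first by apply: ler_wpM2l hKr; exact: expR_ge0.
rewrite /S' rhoE//.
rewrite [leLHS](_ : _ = D * expR T * S * (expR (- theta * lrho t + al) *
  expR ((theta - 1) * lrho t - al) * expR (lrho t))); last by ring.
rewrite -!expRD [X in _ * S * expR X](_ : _ = 0) ?expR0 ?mulr1//; last by ring.
Qed.

(** The kernel is now exp(-del |ln rho(e^k) - j|). Its column sums run over consecutive integers j,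
    and the bound on G(e^j) comes from [Krho_of_samples] at an index i with rho(e^i) near e^j. *)
Lemma reiterated_norm_le_sharp : exists2 C : R, 0 < C & forall f, sum_set A0 A1 f ->
  (NF f < +oo)%E -> sum_set A0 X f /\ (NG f <= C%:E * NF f)%E.
Proof.
have [P P0 hP] := F_lipschitz; have [P' P'0 hP'] := G_lipschitz.
have [C C0 [hC hC2]] := rho_int_growth.
have sig20 : 0 < sig / 2 by rewrite divr_gt0.
have [B B0 hB] := @kernel_bound R q 1 0 del hq ltr01 del0 (lexx _).
have [D D0 hD] := Krho_of_samples.
pose Pm := P + P'.
have Pm0 : 0 <= Pm by rewrite addr_ge0.
(* Membership in A0 + X comes first, since [G] is controlled only there. A finite norm bounds all
   samples of [F], which suffices to apply [Krho_of_samples] at i = 0. *)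
have FX f : sum_set A0 A1 f -> (NF f < +oo)%E -> sum_set A0 X f.
  move=> fS fin.
  have F0 k : 0 <= F f (E k) by rewrite F_ge0 ?expR_gt0.
  have hq' := lq_sample_le hq P0 (@F_ge0 f) (hP f fS).
  have lqfin : (lq q (fun k => F f (E k)) < +oo)%E.
    by apply: le_lt_trans hq' _; rewrite lte_mul_pinfty ?lee_fin ?expR_ge0.
  pose M := fine (lq q (fun k => F f (E k))).
  have FM k : F f (E k) <= M.
    rewrite -lee_fin /M fineK; first by apply: (@lq_ge _ _ (fun k => F f (E k))).
    rewrite ge0_fin_numE//; apply: le_trans (@lq_ge _ _ (fun k => F f (E k)) 0 hq F0).
    by rewrite lee_fin.
  have M0 : 0 <= M by exact: le_trans (FM 0).
  (* Adding 1 ensures positivity, and e^(del C) compensates for a possible drop of ln rho(e^k) below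
     its value at k = 0, which is at most [C]. *)
  have Se : 0 < (M + 1) * expR (del * C) by rewrite mulr_gt0 ?expR_gt0//; lra.
  have [] // := hD f 0 _ fS Se; move=> k k0.
  apply: le_trans (FM k) _; rewrite -mulrA -expRD -mulrDr.
  rewrite -[leLHS]mulr1 ler_pM//; first by lra.
  rewrite -expR0 ler_expR mulr_ge0 ?(ltW del0)//.
  rewrite addrC -[C]opprK subr_ge0; apply: le_trans (hC 0 k k0).
  by rewrite lerDr mulr_ge0 ?(ltW sig20)// ler0z subr_ge0.
pose C1 := expR (Pm * (C + 3)) * (D * expR (del * (C + 2 + 2 * C))).
have C10 : 0 < C1 by rewrite !mulr_gt0 ?expR_gt0.
exists (expR (recip q) * (expR (2 * Pm) * C1 * B `^ recip q) * expR (recip q + 2 * Pm)).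
  by rewrite !mulr_gt0 ?expR_gt0 ?powR_gt0.
move=> f fS fin; have fX := FX f fS fin; split=> //.
have lip (phi : R -> R) p : (forall t, 0 < t -> 0 <= phi t) -> p <= Pm ->
    log_lipschitz p phi -> log_lipschitz Pm phi.
  move=> phi0 pP h s t s0 t0; apply: le_trans (h s t s0 t0) _.
  by rewrite ler_wpM2r ?phi0// ler_expR ler_wpM2r// addr_ge0.
apply: (@Lqnorm_transfer R q Pm C1 B
  (fun j k => expR (- del * `|lrho (E k) - j%:~R|))) => //.
- by move=> j k; rewrite expR_ge0 expR_le1 mulNr oppr_le0 mulr_ge0// ltW.
- move=> r qr k; apply: (hB (fun j => j%:~R)) => // i j _.
  by rewrite mul1r subr0 intrB.
- exact: F_ge0.
- exact: G_ge0.
- by apply: lip (hP f fS) => //; [exact: F_ge0|rewrite /Pm; lra].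
- by apply: lip (hP' f fX) => //; [exact: G_ge0|rewrite /Pm; lra].
move=> j S S0 hS.
(* [Krho_of_samples] takes a positive bound, so [S] is enlarged by an arbitrarily small amount. *)
suff pos S' : 0 < S' -> S <= S' -> G f (E j) <= C1 * S'.
  apply/ler_addgt0Pr => e epos.
  have := pos (S + e / C1); rewrite mulrDr mulrCA mulfV ?gt_eqF// mulr1; apply.
    by rewrite ltr_pwDr// divr_gt0.
  by rewrite lerDl divr_ge0// ltW.
move=> S'0 SS'.
(* At the crossing, j lies within C + 2 of ln rho(e^i). Hence G(e^j) and G(rho(e^i)) are comparable,
   and for k >= i the distance |ln rho(e^k) - j| is at most ln rho(e^k) - ln rho(e^i) plus a
   constant. *)
have [i /andP[ij ji]] := crossing_index sig20 hC j%:~R.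
have hi := hC2 i.
set S'' := S' * expR (del * (C + 2 + 2 * C)).
have [|_ GS] := hD f i S'' fS (mulr_gt0 S'0 (expR_gt0 _)).
  move=> k ik.
  have := hS k; rewrite mulNr expRN ler_pdivrMl ?expR_gt0// => hk.
  apply: le_trans hk _; rewrite mulrC /S'' -mulrA ler_pM ?expR_ge0//.
  rewrite -expRD ler_expR -mulrDr ler_wpM2l ?(ltW del0)//.
  apply: crossing_dist_le C0 ij (ltW ji) hi _ (hC i k ik).
  by rewrite mulr_ge0 ?(ltW sig20)// ler0z subr_ge0.
have GG : G f (E j) <= expR (Pm * (C + 3)) * G f (rho (E i)).
  have rE : rho (E i) = expR (lrho (E i)) by rewrite rhoE ?expR_gt0.
  have := hP' f fX (E j) (rho (E i)); rewrite rE !expR_gt0 !expRK => /(_ isT isT).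
  move/le_trans; apply; rewrite ler_wpM2r ?G_ge0 ?expR_gt0// ler_expR.
  apply: ler_pM => //; first by rewrite lerDr.
  exact: (add1_dist_le ij (ltW ji) hi).
apply: le_trans GG _; rewrite /C1 -mulrA ler_wpM2l ?expR_ge0//.
by apply: le_trans GS _; rewrite /S'' -!mulrA [S' * _]mulrC.
Qed.

Lemma fine_le_mul (C : R) (x y : \bar R) : 0 <= C -> (0 <= x)%E -> (0 <= y)%E ->
  (x <= C%:E * y)%E -> (y < +oo)%E -> (x < +oo)%E /\ fine x <= C * fine y.
Proof.
move=> C0 x0 y0; case: y y0 => [y| |]// _ + _; case: x x0 => [x| |]//.
by rewrite -EFinM lee_fin => _ xy; rewrite ltry.
Qed.

Lemma Kspace_reiteration :
  Kspace A0 X theta q a ~=~ Kspace A0 A1 (theta * sig) q asharp.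
Proof.
have [C C0 hC] := sharp_norm_le_reiterated; have [D D0 hD] := reiterated_norm_le_sharp.
have NGE f : sum_set A0 X f -> Lqnorm q `]0%R, +oo[
    (fun u => (u `^ (- theta - recip q) * a u)%:E * Kfun A0 X u f)%E = NG f.
  move=> fX; apply: eq_Lqnorm => u /=; rewrite in_itv /= andbT => u0.
  exact: Kspace_RE.
have NFE f : sum_set A0 A1 f -> Lqnorm q `]0%R, +oo[
    (fun u => (u `^ (- (theta * sig) - recip q) * asharp u)%:E *
      Kfun A0 A1 u f)%E = NF f.
  move=> fA; apply: eq_Lqnorm => u /=; rewrite in_itv /= andbT => u0.
  exact: Kspace_sharpE.
have XA f : sum_set A0 X f -> sum_set A0 A1 f.
  by move=> [f0 f0A [g [gA _] <-]]; apply: sum_setD => //; exact: sum_set_fst.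
have FG f : carrier (Kspace A0 X theta q a) f ->
    (NF f < +oo)%E /\ fine (NF f) <= C * fine (NG f).
  move=> /= [fX]; rewrite NGE// => NGfin.
  by apply: fine_le_mul; rewrite ?Lqnorm_ge0 ?hC// ltW.
have GF f : carrier (Kspace A0 A1 (theta * sig) q asharp) f ->
    [/\ sum_set A0 X f, (NG f < +oo)%E & fine (NG f) <= D * fine (NF f)].
  move=> /= [fA]; rewrite NFE// => NFfin; have [fX GFf] := hD f fA NFfin.
  by have [] := fine_le_mul (ltW D0) (Lqnorm_ge0 _ _ _) (Lqnorm_ge0 _ _ _) GFf NFfin.
split; split.
- move=> f fK; have [NFfin _] := FG f fK.
  by case: fK => fX _; split; [exact: XA|rewrite NFE//; exact: XA].
- exists C => f fK; have [_ h] := FG f fK.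
  by case: fK => fX _ /=; rewrite NGE ?NFE//; exact: XA.
- move=> f fK; have [fX NGfin _] := GF f fK.
  by split => //; rewrite NGE.
- exists D => f fK; have [fX _ h] := GF f fK.
  by case: fK => fA _ /=; rewrite NGE ?NFE.
Qed.

End reiteration.

Unset Implicit Arguments.

Theorem theorem21 (R : realType) (V : topologicalLmodType R) (A0 A1 : qspace V)
    (hA : compatible_couple A0 A1)
    (hA01 : carrier A0 `&` carrier A1 <> [set 0])
    (theta1 theta : R) (htheta1 : 0 < theta1 < 1) (htheta : 0 <= theta < 1)
    (q1 r1 r : \bar R) (hq1 : (0 < q1)%E) (hr1 : (0 < r1)%E) (hr : (0 < r)%E)
    (a a1 b1 : R -> R) (ha : SV a) (ha1 : SV a1) (hb1 : SV b1)
    (hb1a1 : (Lqnorm r1 `]0%R, 1%R[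
       (fun s => (s `^ (- recip r1) * (b1 s / a1 s))%:E) < +oo)%E)
    (ha0 : theta = 0 ->
       (Lqnorm r `]1%R, +oo[ (fun s => (s `^ (- recip r) * a s)%:E) < +oo)%E) :
  let c1 := fun t : R => a1 t * fine (Lqnorm r1 `]0, t[
    (fun s => (s `^ (- recip r1) * (b1 s / a1 s))%:E)) in
  let rho := fun t : R => t `^ theta1 * (1 / c1 t) in
  let eta := theta * theta1 in
  let asharp := fun t : R => c1 t `^ theta * a (rho t) in
  Kspace A0 (Rspace A0 A1 theta1 r1 b1 q1 a1) theta r a
    ~=~ Kspace A0 A1 eta r asharp.
Proof.
move: htheta1 htheta => /andP[s0 s1] /andP[t0 t1] c1 rho eta asharp.
have [_ hA0 hA1 _ _] := hA.
have [[pa pa1] pb1] := (SV_pos ha, SV_pos ha1, SV_pos hb1).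
have [[sa sa1] sb1] := (SV_log_slow ha, SV_log_slow ha1, SV_log_slow hb1).
exact: (Kspace_reiteration hA0 hA1 s0 s1 hq1 hr1 pa1 pb1 sa1 sb1 hb1a1 t0 t1 hr pa sa).
Qed.
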